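(* Let $V$ be an $n$-dimensional vector space over $\mathbb{C}$ and let $W$ be a finite complex reflection subgroup of $\mathrm{GL}(V)$. Let $F_n$ be the skew field of fractions of the $n$-th Weyl algebra $A_n$ over $\mathbb{C}$, identified with the ring of differential operators on $\mathbb{C}[V]=\mathbb{C}[x_1,\dots,x_n]$, with the action of $W$ on $F_n$ induced from its action on $V$. Then the skew field of invariants satisfies $F_n^W\cong F_n$ (isomorphism of $\mathbb{C}$-algebras).
   Context: A complex reflection in $\mathrm{GL}(V)$ is a non-identity element acting as the identity on some hyperplane of $V$; a finite subgroup $W\subset \mathrm{GL}(V)$ is a complex reflection group if it is generated by the complex reflections it contains. Fix a basis of $V$ and let $x_1,\dots,x_n$ be the dual basis of $V^*$, so $S(V^* )=\mathbb{C}[x_1,\dots,x_n]$. The group $W$ acts on $S(V^* )$ by $(w.f)(v)=f(w^{-1}v)$. The Weyl algebra $A_n$ (generators $x_1,\dots,x_n,\partial_1,\dots,\partial_n$ with $[\partial_i,x_j]=\delta_{ij}$ and all other commutators zero) is identified with the ring of differential operators on $\mathbb{C}[x_1,\dots,x_n]$; $W$ acts on it by $w*d=w\circ d\circ w^{-1}$. This action extends uniquely to the skew field of fractions $F_n$ of $A_n$, and $F_n^W$ denotes the fixed elements. *)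

(* Defs.v *)
From HB Require Import structures.
From mathcomp Require Import all_boot all_order all_algebra finmap.
From mathcomp Require Import mpoly boolp.

Set Implicit Arguments.
Unset Strict Implicit.
Unset Printing Implicit Defensive.

Import GRing.Theory.

Local Open Scope ring_scope.

(* End_K(M), the algebra of all K-linear endomorphisms of M under             *)
(* composition; 'End(M) is only available for M of finite dimension. M is     *)
(* taken to be an algebra because algType excludes the zero ring.             *)
Section LinearEnd.
Variables (K : comNzRingType) (M : lalgType K).

Record linend := Linend { linend_fun :> M -> M; _ : linear linend_fun }.

HB.instance Definition _ := gen_eqMixin linend.
HB.instance Definition _ := gen_choiceMixin linend.

Lemma linend_linear (f : linend) : linear f.
Proof. by case: f. Qed.

HB.instance Definition _ (f : linend) :=
  GRing.isLinear.Build K M M *:%R f (linend_linear f).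

Lemma linendP (f g : linend) : f =1 g -> f = g.
Proof.
case: f g => [f lf] [g lg] /= /funext efg.
by case: g / efg lg => lg; rewrite (Prop_irrelevance lf lg).
Qed.

Definition linend0 := Linend (linearP (\0 : {linear M -> M})).
Definition linend_opp (f : linend) := Linend (linearP (\- f)).
Definition linend_add (f g : linend) := Linend (linearP (f \+ g)).
Definition linend1 := Linend (linearP (@idfun M : {linear M -> M})).
Definition linend_mul (f g : linend) := Linend (linearP (f \o g)).
Fact linend_scale_subproof a (f : linend) : linear (a \*: f).
Proof. by move=> b x y; rewrite /= linearP scalerDr !scalerA mulrC. Qed.
Definition linend_scale (a : K) (f : linend) :=
  Linend (linend_scale_subproof a f).

Fact linend_addA : associative linend_add.
Proof. by move=> f g h; apply: linendP => x /=; rewrite addrA. Qed.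
Fact linend_addC : commutative linend_add.
Proof. by move=> f g; apply: linendP => x /=; rewrite addrC. Qed.
Fact linend_add0 : left_id linend0 linend_add.
Proof. by move=> f; apply: linendP => x /=; rewrite add0r. Qed.
Fact linend_addN : left_inverse linend0 linend_opp linend_add.
Proof. by move=> f; apply: linendP => x /=; rewrite addNr. Qed.

HB.instance Definition _ := GRing.isZmodule.Build linend
  linend_addA linend_addC linend_add0 linend_addN.

Fact linend_mulA : associative linend_mul.
Proof. by move=> f g h; apply: linendP. Qed.
Fact linend_mul1 : left_id linend1 linend_mul.
Proof. by move=> f; apply: linendP. Qed.
Fact linend_mulr1 : right_id linend1 linend_mul.
Proof. by move=> f; apply: linendP. Qed.
Fact linend_mulDl : left_distributive linend_mul +%R.
Proof. by move=> f g h; apply: linendP. Qed.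
Fact linend_mulDr : right_distributive linend_mul +%R.
Proof. by move=> f g h; apply: linendP => x /=; rewrite linearD. Qed.
Fact linend1_neq0 : linend1 != 0.
Proof.
apply/eqP => /(congr1 (fun f : linend => f 1)) /= /eqP.
by rewrite oner_eq0.
Qed.

HB.instance Definition _ := GRing.Zmodule_isNzRing.Build linend
  linend_mulA linend_mul1 linend_mulr1 linend_mulDl linend_mulDr linend1_neq0.

Fact linend_scaleA a b (f : linend) :
  linend_scale a (linend_scale b f) = linend_scale (a * b) f.
Proof. by apply: linendP => x /=; rewrite scalerA. Qed.
Fact linend_scale1 : left_id 1 linend_scale.
Proof. by move=> f; apply: linendP => x /=; rewrite scale1r. Qed.
Fact linend_scaleDr : right_distributive linend_scale +%R.
Proof. by move=> a f g; apply: linendP => x /=; rewrite scalerDr. Qed.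
Fact linend_scaleDl f : {morph linend_scale^~ f : a b / a + b}.
Proof. by move=> a b; apply: linendP => x /=; rewrite scalerDl. Qed.

HB.instance Definition _ := GRing.Zmodule_isLmodule.Build K linend
  linend_scaleA linend_scale1 linend_scaleDr linend_scaleDl.

Fact linend_scaleAl a (f g : linend) : a *: (f * g) = (a *: f) * g.
Proof. by apply: linendP. Qed.
Fact linend_scaleAr a (f g : linend) : a *: (f * g) = f * (a *: g).
Proof. by apply: linendP => x /=; rewrite linearZ. Qed.

HB.instance Definition _ :=
  GRing.Lmodule_isLalgebra.Build K linend linend_scaleAl.
HB.instance Definition _ :=
  GRing.Lalgebra_isAlgebra.Build K linend linend_scaleAr.

Lemma linendDE (f g : linend) x : (f + g) x = f x + g x. Proof. by []. Qed.
Lemma linendME (f g : linend) x : (f * g) x = f (g x). Proof. by []. Qed.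
Lemma linendZE a (f : linend) x : (a *: f) x = a *: f x. Proof. by []. Qed.
Lemma linend_sumE (I : Type) (r : seq I) (P : pred I) (F : I -> linend) x :
  (\sum_(i <- r | P i) F i) x = \sum_(i <- r | P i) F i x.
Proof. by elim/big_rec2: _ => // i y f _ <-. Qed.

End LinearEnd.

Section WeylAlgebra.
Variables (K : comNzRingType) (n : nat).

Fact mulX_subproof i : linear ( *%R ('X_i : {mpoly K[n]})).
Proof. by move=> a p q; rewrite mulrDr scalerAr. Qed.

Definition mulX i : linend {mpoly K[n]} := Linend (mulX_subproof i).
Definition derX i : linend {mpoly K[n]} := Linend (linearP (mderiv i)).

Definition weyl_pred : {pred linend {mpoly K[n]}} := fun d =>
  `[< forall S : {pred linend {mpoly K[n]}}, subalg_closed S ->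
        (forall i, mulX i \in S) -> (forall i, derX i \in S) -> d \in S >].

(* The subalgebra of End_K(K[x_1, ..., x_n]) generated by the x_i and the     *)
(* d/dx_i. When K is a field of characteristic 0, this is the Weyl algebra    *)
(* A_n, and it is the ring of all differential operators on K[x_1, ..., x_n]. *)
Record weyl :=
  Weyl { weyl_op :> linend {mpoly K[n]}; _ : weyl_op \in weyl_pred }.

HB.instance Definition _ := [isSub for weyl_op].
HB.instance Definition _ := [Choice of weyl by <:].

Lemma weyl_closed : subalg_closed weyl_pred.
Proof.
split.
- by apply/asboolP => S [].
- move=> a u v /asboolP uP /asboolP vP; apply/asboolP => S clS xS dS.
  by case: (clS) => _ linS _; apply: linS; [apply: uP | apply: vP].
- move=> u v /asboolP uP /asboolP vP; apply/asboolP => S clS xS dS.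
  by case: (clS) => _ _ mulS; apply: mulS; [apply: uP | apply: vP].
Qed.

HB.instance Definition _ := GRing.SubChoice_isSubAlgebra.Build K
  (linend {mpoly K[n]}) weyl_pred weyl (GRing.subalg_closed_semi weyl_closed).

Lemma mulX_weyl i : mulX i \in weyl_pred.
Proof. by apply/asboolP => S _ xS _. Qed.
Lemma derX_weyl i : derX i \in weyl_pred.
Proof. by apply/asboolP => S _ _ dS. Qed.

End WeylAlgebra.

Section GeneralLinear.
Variables (K : fieldType) (V : vectType K).

Record GL := MkGL { GLval :> 'End(V); _ : lker GLval == 0%VS }.

HB.instance Definition _ := [isSub for GLval].
HB.instance Definition _ := [Choice of GL by <:].

Lemma GL_lker (g : GL) : lker g == 0%VS. Proof. by case: g. Qed.

Fact GL1_subproof : lker (\1%VF : 'End(V)) == 0%VS.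
Proof. by apply/lker0P => x y; rewrite !lfunE. Qed.
Fact GLV_subproof (g : GL) : lker (g^-1)%VF == 0%VS.
Proof.
apply/lker0P/(can_inj (g := g)) => v; have := lker0_compfV (GL_lker g).
by move/lfunP/(_ v); rewrite !lfunE.
Qed.
Fact GLM_subproof (g h : GL) : lker (g \o h)%VF == 0%VS.
Proof.
apply/lker0P => x y; rewrite !lfunE /=.
by move/(lker0P (GL_lker g))/(lker0P (GL_lker h)).
Qed.

Definition GL1 := MkGL GL1_subproof.
Definition GLV g := MkGL (GLV_subproof g).
Definition GLM g h := MkGL (GLM_subproof g h).

Fact GLMA : associative GLM.
Proof. by move=> f g h; apply: val_inj; rewrite /= comp_lfunA. Qed.
Fact GL1M : left_id GL1 GLM.
Proof. by move=> g; apply: val_inj; rewrite /= comp_lfun1l. Qed.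
Fact GLM1 : right_id GL1 GLM.
Proof. by move=> g; apply: val_inj; rewrite /= comp_lfun1r. Qed.
Fact GLVM : left_inverse GL1 GLV GLM.
Proof. by move=> g; apply: val_inj; rewrite /= lker0_compVf ?GL_lker. Qed.
Fact GLMV : right_inverse GL1 GLV GLM.
Proof. by move=> g; apply: val_inj; rewrite /= lker0_compfV ?GL_lker. Qed.

HB.instance Definition _ := isGroup.Build GL GLMA GL1M GLM1 GLVM GLMV.

Lemma GL1E v : (1%g : GL) v = v. Proof. by rewrite lfunE. Qed.
Lemma GLME (g h : GL) v : (g * h)%g v = g (h v). Proof. by rewrite lfunE. Qed.
Lemma GLVK (g : GL) : cancel g (g^-1)%g.
Proof. by move=> v; rewrite -GLME mulVg GL1E. Qed.
Lemma GLKV (g : GL) : cancel (g^-1)%g g.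
Proof. by move=> v; rewrite -GLME mulgV GL1E. Qed.

Definition complex_reflection (g : GL) : Prop :=
  g != 1%g /\ exists H : {vspace V},
    (\dim H).+1 = \dim {:V} /\ {in H, forall v, g v = v}.

(* The last clause says that W is generated by the reflections it contains.   *)
Definition complex_reflection_group (W : {fset GL}) : Prop :=
  group_closed [pred g in W] /\
  forall H : {pred GL}, group_closed H ->
    (forall g, g \in W -> complex_reflection g -> g \in H) ->
    {subset W <= H}.

End GeneralLinear.

Section Action.
Variables (K : fieldType) (V : vectType K) (n : nat) (e : n.-tuple V).

(* (g . f)(v) = f(g^-1 v), as stated by GLact_eval; 'X_j stands for the j-th  *)
(* vector of the dual basis of e, so g . x_j = \sum_i x_j(g^-1 e_i) x_i.      *)
Definition GLact (g : GL V) : {mpoly K[n]} -> {mpoly K[n]} :=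
  comp_mpoly [tuple \sum_(i < n) coord e j ((g^-1)%g e`_i) *: 'X_i | j < n].

HB.instance Definition _ g := GRing.LRMorphism.on (GLact g).

Lemma GLactX g j :
  GLact g 'X_j = \sum_(i < n) coord e j ((g^-1)%g e`_i) *: 'X_i.
Proof. by rewrite /GLact comp_mpolyXU -tnth_nth tnth_mktuple. Qed.

Lemma GLact_deriv g j p :
  (GLact g p)^`M(j) =
    \sum_(k < n) coord e k ((g^-1)%g e`_j) *: GLact g (p^`M(k)).
Proof.
pose c k := coord e k ((g^-1)%g e`_j); rewrite -/c.
have dC (a : K) : (GLact g a%:MP)^`M(j) =
    \sum_(k < n) c k *: GLact g ((a%:MP)^`M(k)).
  rewrite /GLact comp_mpolyC mderivC big1 // => k _.
  by rewrite mderivC raddf0 scaler0.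
have dM u v :
    (GLact g u)^`M(j) = \sum_(k < n) c k *: GLact g (u^`M(k)) ->
    (GLact g v)^`M(j) = \sum_(k < n) c k *: GLact g (v^`M(k)) ->
    (GLact g (u * v))^`M(j) = \sum_(k < n) c k *: GLact g ((u * v)^`M(k)).
  move=> du dv; rewrite rmorphM mderivM du dv mulr_suml mulr_sumr -big_split.
  apply: eq_bigr => k _ /=; rewrite mderivM raddfD /= !rmorphM scalerDr.
  by rewrite scalerAl scalerAr.
have dX i : (GLact g 'X_i)^`M(j) =
    \sum_(k < n) c k *: GLact g (('X_i : {mpoly K[n]})^`M(k)).
  have dXi k l : ('X_k : {mpoly K[n]})^`M(l) = ((k == l)%:R)%:MP.
    rewrite mderivX mnm1E; case: eqP => [->|_]; last by rewrite scale0r mpolyC0.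
    by rewrite scale1r -[X in (X - _)%MM]add0m addmK mpolyX0 mpolyC1.
  rewrite GLactX raddf_sum /= (bigD1 j) //= big1 ?addr0 => [|k nkj]; last first.
    by rewrite mderivZ dXi (negPf nkj) mpolyC0 scaler0.
  rewrite mderivZ dXi eqxx (bigD1 i) //= big1 ?addr0 => [|k nki]; last first.
    by rewrite dXi eq_sym (negPf nki) mpolyC0 raddf0 scaler0.
  by rewrite dXi eqxx !mpolyC1 rmorph1.
have dm (m : 'X_{1..n}) : (GLact g 'X_[m])^`M(j) =
    \sum_(k < n) c k *: GLact g (('X_[m] : {mpoly K[n]})^`M(k)).
  rewrite mpolyXE_id; elim/big_rec: _ => [|i x _ IH].
    by rewrite -mpolyC1; apply: dC.
  apply: (dM _ _ _ IH); elim: (m i) => [|q IHq].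
    by rewrite expr0 -mpolyC1; apply: dC.
  by rewrite exprS; apply: dM.
elim/mpolyind: p => [|a m p _ _ IHp].
  by rewrite -(mpolyC0 n K); apply: dC.
rewrite raddfD /= mderivD IHp linearZ /= mderivZ dm scaler_sumr -big_split.
apply: eq_bigr => k _ /=.
by rewrite mderivD mderivZ [GLact g (_ + _)]linearP scalerDr !scalerA mulrC.
Qed.

Hypothesis he : basis_of {:V} e.

Lemma GLact_eval g p v :
  (GLact g p).@[fun j => coord e j v] = p.@[fun j => coord e j ((g^-1)%g v)].
Proof.
rewrite /GLact comp_mpoly_meval; apply: meval_eq => j.
rewrite tnth_mktuple raddf_sum /= [in RHS](coord_basis he (memvf v)).
rewrite !linear_sum; apply: eq_bigr => i _.
by rewrite mevalZ mevalXU !linearZ /= mulrC.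
Qed.

Lemma GLact_comp g h p : GLact g (GLact h p) = GLact (g * h)%g p.
Proof.
elim/mpolyind: p => [|a m p _ _ IHp]; first by rewrite !raddf0.
rewrite !raddfD /= !linearZ /= IHp; congr (_ *: _ + _).
rewrite mpolyXE_id !rmorph_prod /= ; apply: eq_bigr => j _.
rewrite !rmorphXn /=; congr (_ ^+ _); rewrite !GLactX linear_sum /=.
under eq_bigr do rewrite linearZ /= GLactX scaler_sumr.
rewrite exchange_big; apply: eq_bigr => i _.
under eq_bigr do rewrite scalerA; rewrite -scaler_suml; congr (_ *: _).
have -> : ((g * h)^-1)%g e`_i = (h^-1)%g ((g^-1)%g e`_i).
  by rewrite invgM GLME.
rewrite [(g^-1)%g _ in RHS](coord_basis he (memvf _)).
by rewrite !linear_sum; apply: eq_bigr => k _; rewrite !linearZ /= mulrC.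
Qed.

Lemma GLact1 p : GLact 1%g p = p.
Proof.
rewrite -[RHS]comp_mpoly_id; congr (_ \mPo _); apply: eq_from_tnth => j.
rewrite !tnth_mktuple invg1 (bigD1 j) //= big1 ?addr0 => [|i nij].
  by rewrite GL1E coord_free ?(basis_free he) // eqxx scale1r.
by rewrite GL1E coord_free ?(basis_free he) // (negPf nij) scale0r.
Qed.

Definition GLact_lin g : linend {mpoly K[n]} := Linend (linearP (GLact g)).

Lemma GLact_linM g h : GLact_lin g * GLact_lin h = GLact_lin (g * h)%g.
Proof. by apply: linendP => p; apply: GLact_comp. Qed.
Lemma GLact_lin1 : GLact_lin 1%g = 1.
Proof. by apply: linendP => p; apply: GLact1. Qed.

Lemma GLact_weyl g (d : weyl K n) :
  GLact_lin g * (d : linend _) * GLact_lin (g^-1)%g \in @weyl_pred K n.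
Proof.
have gV : GLact_lin (g^-1)%g * GLact_lin g = 1.
  by rewrite GLact_linM mulVg GLact_lin1.
case: (weyl_closed K n) => w1 wlin wM.
have wsum (c : 'I_n -> K) (D : 'I_n -> linend {mpoly K[n]}) :
    (forall i, D i \in @weyl_pred K n) -> \sum_i c i *: D i \in @weyl_pred K n.
  move=> wD; elim/big_rec: _ => [|i x _ wx]; last exact: wlin.
  by rewrite -(subrr 1) -scaleN1r addrC; apply: wlin.
case: d => d /= /asboolP wd.
pose S : {pred linend {mpoly K[n]}} :=
  fun u => GLact_lin g * u * GLact_lin (g^-1)%g \in @weyl_pred K n.
apply: (wd S) => [|i|j].
- split; rewrite ?unfold_in.
  + by rewrite mulr1 GLact_linM mulgV GLact_lin1.
  + move=> a u v; rewrite !unfold_in mulrDr mulrDl -scalerAr -scalerAl.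
    exact: wlin.
  + move=> u v; rewrite !unfold_in => wu wv.
    by have := wM _ _ wu wv; rewrite -!mulrA [X in _ * (_ * X)]mulrA gV mul1r.
- rewrite unfold_in; suff -> : GLact_lin g * mulX K i * GLact_lin (g^-1)%g =
      \sum_(k < n) coord e i ((g^-1)%g e`_k) *: mulX K k.
    by apply: wsum => k; apply: mulX_weyl.
  apply: linendP => p; rewrite !linendME linend_sumE.
  transitivity (GLact g ('X_i * GLact (g^-1)%g p)); first by [].
  rewrite rmorphM /= GLactX GLact_comp mulgV GLact1 mulr_suml.
  by apply: eq_bigr => k _; rewrite -scalerAl.
- rewrite unfold_in; suff -> : GLact_lin g * derX K j * GLact_lin (g^-1)%g =
      \sum_(k < n) coord e k (g e`_j) *: derX K k.
    by apply: wsum => k; apply: derX_weyl.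
  apply: linendP => p; rewrite !linendME linend_sumE.
  transitivity (GLact g (GLact (g^-1)%g p)^`M(j)); first by [].
  rewrite GLact_deriv invgK linear_sum; apply: eq_bigr => k _.
  by rewrite linearZ /= GLact_comp mulgV GLact1.
Qed.

(* g * d = g \o d \o g^-1                                                     *)
Definition weylact g (d : weyl K n) : weyl K n := Weyl (GLact_weyl g d).

End Action.

Section SkewFieldOfFractions.
Variable K : comNzRingType.

(* Every element of F is a right fraction over A; this determines (F, iota)   *)
(* up to a unique isomorphism. Such an F exists iff A is a right Ore domain,  *)
(* as A_n is over a field of characteristic 0.                                *)
Definition skew_field_of_fractions (A : algType K) (F : unitAlgType K)
    (iota : {lrmorphism A -> F}) : Prop :=
  [/\ forall x : F, x != 0 -> x \is a GRing.unit,
      injective iota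
    & forall x : F, exists a b : A, b != 0 /\ x = iota a / iota b].

Variables (F : unitAlgType K) (T : choiceType) (W : {fset T}).
Variable act : T -> {lrmorphism F -> F}.

Definition invariant_pred : {pred F} :=
  fun x => `[< forall g, g \in W -> act g x = x >].

(* F^W, as a subalgebra of F                                                  *)
Record invariants :=
  Invariants { invariants_val :> F; _ : invariants_val \in invariant_pred }.

HB.instance Definition _ := [isSub for invariants_val].
HB.instance Definition _ := [Choice of invariants by <:].

Lemma invariant_closed : subalg_closed invariant_pred.
Proof.
split.
- by apply/asboolP => g _; rewrite rmorph1.
- move=> a x y /asboolP xW /asboolP yW; apply/asboolP => g gW.
  have -> : act g (a *: x + y) = a *: act g x + act g y by exact: linearP.
  by rewrite xW ?yW.
- move=> x y /asboolP xW /asboolP yW; apply/asboolP => g gW.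
  have -> : act g (x * y) = act g x * act g y by exact: rmorphM.
  by rewrite xW ?yW.
Qed.

HB.instance Definition _ := GRing.SubChoice_isSubAlgebra.Build K
  F invariant_pred invariants (GRing.subalg_closed_semi invariant_closed).

End SkewFieldOfFractions.

(* Main.v *)
Require Import Defs.
From mathcomp Require Import all_boot all_order all_algebra finmap.
From mathcomp Require Import mpoly complex boolp reals.
From HB Require Import structures.
From mathcomp Require Import generic_quotient.

(* Chevalley's theorem provides homogeneous invariants f_1, ..., f_n generating
   K[x]^W whose Jacobian determinant is nonzero. Dividing by it, one gets vector
   fields D_1, ..., D_n with rational coefficients and D_i(f_j) = delta_ij; such
   vector fields are unique, so the D_i commute and are W-invariant. Hence
   x_i |-> f_i, d_i |-> D_i embeds A_n, and then F_n, into F_n^W. Conversely,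
   K[x] is a finite module over K[x]^W and d_j = sum_i (d_j f_i) D_i, so that
   F_n is spanned by polynomials as a right vector space over the image of F_n;
   averaging over W moves every invariant element into that image.            *)

Set Implicit Arguments.
Unset Strict Implicit.
Unset Printing Implicit Defensive.

Import GRing.Theory Num.Theory.
Local Open Scope ring_scope.

(** * Ranks over a domain *)

(** Reflections enter Chevalley's theorem only through one fact: p - s p is divisible by a linear
    form, which turns a relation among invariants into one whose coefficients have smaller degree.
    Instead of algebraic independence of the f_i, the argument carries the rank of their Jacobian
    matrix over the fraction field. Its rows are independent for every irredundant family; this
    bounds the length by n before anything is known about generation, so that a maximal family
    exists. Its columns are independent because a derivation killing all invariants kills K[x],
    which is algebraic over them. Hence there are exactly n generators and the determinant is
    nonzero. On the noncommutative side no degree over the image of F_n is computed. A finite right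
    span that is stable under left multiplication by A_n already contains all fractions, by a linear
    dependence among powers of the denominator. *)

Section FractionRank.
Local Open Scope quotient_scope.
Variable R : idomainType.
Local Notation tofrac := (@tofrac R).

Lemma fractionP (x : {fraction R}) :
  exists a b : R, b != 0 /\ x = tofrac a / tofrac b.
Proof.
elim/quotW: x => x; exists \n_x, \d_x; split; first exact: denom_ratioP.
have nz : tofrac \d_x != 0 by rewrite tofrac_eq0 denom_ratioP.
apply: (mulIf nz); rewrite mulfVK //.
unlock FracField.tofrac; rewrite -[LHS]FracField.pi_mul; apply/eqmodP.
rewrite /= FracField.equivfE /FracField.mulf !numden_Ratio ?oner_neq0 //;
  rewrite ?mulr1 ?denom_ratioP //.
by rewrite mulrC.
Qed.

Lemma common_denominator (I : finType) (x : I -> {fraction R}) :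
  exists (d : R) (a : I -> R), d != 0 /\ forall i, tofrac d * x i = tofrac (a
    i).
Proof.
have [a /choice [b ab]] := choice (fun i => fractionP (x i)).
exists (\prod_i b i), (fun i => a i * \prod_(j | j != i) b j); split.
  by apply/prodf_neq0 => i _; case: (ab i).
move=> i; have [nz ->] := ab i.
have nz' : tofrac (b i) != 0 by rewrite tofrac_eq0.
by rewrite (bigD1 i) //= !rmorphM /= mulrC mulrA mulfVK.
Qed.

(** A left null vector over the fraction field becomes one over R once its entries are brought to a
    common denominator. *)
Lemma row_free_tofrac r n (A : 'M[R]_(r, n)) :
  (forall g : 'I_r -> R, (forall k, \sum_i g i * A i k = 0) ->
     forall i, g i = 0) ->
  row_free (map_mx tofrac A).
Proof.
move=> freeA; rewrite -kermx_eq0; apply/eqP/row_matrixP => k; rewrite row0.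
set v := row k _; have vA : v *m map_mx tofrac A = 0.
  by rewrite -row_mul mulmx_ker row0.
have [d [a [nz da]]] := common_denominator (v 0).
apply/rowP => i; rewrite [RHS]mxE; apply/eqP.
have nzd : tofrac d != 0 by rewrite tofrac_eq0.
rewrite -(mulrI_eq0 _ (mulfI nzd)) da tofrac_eq0; apply/eqP.
apply: (freeA a) => j; apply/eqP; rewrite -tofrac_eq0 rmorph_sum /=.
have /(congr1 (fun u : 'rV_n => tofrac d * u 0 j)) := vA.
rewrite !mxE mulr0 mulr_sumr => vAj.
rewrite -[X in _ == X]vAj; apply/eqP; apply: eq_bigr => l _.
by rewrite mulrA da mxE rmorphM.
Qed.

End FractionRank.

(** * The Reynolds operator *)

Section Reynolds.
Variables (K : numFieldType) (n : nat) (T : groupType) (W : {fset T}).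
Variable op : T -> {lrmorphism {mpoly K[n]} -> {mpoly K[n]}}.
Hypothesis W_group : group_closed [pred g in W].
Hypothesis op1 : forall p, op 1%g p = p.
Hypothesis opM : forall g h p, op g (op h p) = op (g * h)%g p.
Implicit Types (p q : {mpoly K[n]}) (g h : T).

Definition fixed_poly p := forall g, g \in W -> op g p = p.
Definition avg p := (#|` W|%:R)^-1 *: \sum_(g <- W) op g p.

Lemma memW1 : 1%g \in W. Proof. by case: W_group. Qed.
Lemma memWV g : g \in W -> g^-1%g \in W.
Proof. exact: (group_closedV W_group). Qed.
Lemma memWM g h : g \in W -> h \in W -> (g * h)%g \in W.
Proof. by move=> gW hW; exact: (group_closedM W_group gW hW). Qed.

Lemma perm_mulW h : h \in W -> perm_eq [seq (h * g)%g | g <- W] W.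
Proof.
move=> hW; apply: uniq_perm; rewrite ?fset_uniq //.
  by rewrite map_inj_uniq ?fset_uniq //; apply: mulgI.
move=> g; apply/mapP/idP => [[k kW ->]|gW]; first exact: memWM.
by exists (h^-1 * g)%g; rewrite ?mulVKg //; apply: memWM => //; apply: memWV.
Qed.

Lemma card_W_neq0 : (#|` W|%:R : K) != 0.
Proof. by rewrite pnatr_eq0 cardfs_eq0; apply/fset0Pn; exists 1%g;
  apply: memW1. Qed.

Lemma op_sumW h p : h \in W -> op h (\sum_(g <- W) op g p) = \sum_(g <- W) op g
  p.
Proof.
move=> hW; rewrite linear_sum /= -[RHS](perm_big _ (perm_mulW hW)) big_map.
by apply: eq_bigr => g _; rewrite opM.
Qed.

Lemma op_prodW h p : h \in W -> op h (\prod_(g <- W) op g p) = \prod_(g <- W)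
  op g p.
Proof.
move=> hW; rewrite rmorph_prod /= -[RHS](perm_big _ (perm_mulW hW)) big_map.
by apply: eq_bigr => g _; rewrite opM.
Qed.

Lemma avg_invariant p : fixed_poly (avg p).
Proof. by move=> g gW; rewrite linearZ /= op_sumW. Qed.

Lemma avg_id p : fixed_poly p -> avg p = p.
Proof.
move=> ip; rewrite /avg big_seq (eq_bigr (fun=> p)) => [|g gW]; last exact: ip.
rewrite -big_seq big_const_seq count_predT iter_addr_0 -scaler_nat scalerA.
by rewrite mulVf ?scale1r ?card_W_neq0.
Qed.

Lemma avg_is_linear : linear avg.
Proof.
move=> a p q; rewrite /avg scalerA mulrC -scalerA -scalerDr; congr (_ *: _).
by rewrite scaler_sumr -big_split; apply: eq_bigr => g _; rewrite /= linearP.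
Qed.
HB.instance Definition _ := GRing.isLinear.Build K _ _ _ avg avg_is_linear.

Lemma avgMl p q : fixed_poly q -> avg (p * q) = avg p * q.
Proof.
move=> iq; rewrite /avg -scalerAl mulr_suml; congr (_ *: _).
by rewrite [LHS]big_seq [RHS]big_seq; apply: eq_bigr => g gW;
  rewrite rmorphM /= iq.
Qed.

Lemma fixed_poly0 : fixed_poly 0. Proof. by move=> g _; rewrite rmorph0. Qed.
Lemma fixed_polyD p q : fixed_poly p -> fixed_poly q -> fixed_poly (p + q).
Proof. by move=> ip iq g gW; rewrite rmorphD /= ip ?iq. Qed.
Lemma fixed_polyM p q : fixed_poly p -> fixed_poly q -> fixed_poly (p * q).
Proof. by move=> ip iq g gW; rewrite rmorphM /= ip ?iq. Qed.
Lemma fixed_polyZ a p : fixed_poly p -> fixed_poly (a *: p).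
Proof. by move=> ip g gW; rewrite linearZ /= ip. Qed.

End Reynolds.

(** * Chevalley's theorem *)

Section Homogeneous.
Variables (K : idomainType) (n : nat).
Implicit Types (p q : {mpoly K[n]}) (m : 'X_{1..n}).

Lemma pihomog0E p : pihomog mdeg 0 p = (p@_0)%:MP.
Proof.
apply/mpolyP => m; rewrite mcoeffC; have [->|nz] := eqVneq m 0%MM.
  rewrite mulr1; elim/mpolyind: p => [|c m' p _ _ IH];
    first by rewrite pihomog0.
  rewrite pihomogD !mcoeffD IH linearZ /= pihomogX; congr (_ + _).
  rewrite !mcoeffZ mdeg_eq0; case: eqP => [->//|ne].
  by rewrite mcoeff0 mcoeffX (introF eqP ne).
by rewrite mulr0 (dhomog_nemf_coeff (pihomogP _ _ _)) // mdeg_eq0.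
Qed.

Lemma dhomog_coeff0 d p : (0 < d)%N -> p \is d.-homog -> p@_0 = 0.
Proof. by move=> d0 hp; rewrite (dhomog_nemf_coeff hp) //= mf0 eq_sym -lt0n.
  Qed.

Lemma msize_dhomog d p : p \is d.-homog -> (msize p <= d.+1)%N.
Proof.
move/dhomogP => hp; rewrite msizeE big_seq; elim/big_ind: _ => //.
  by move=> x y hx hy; rewrite geq_max hx.
by move=> m /hp ->.
Qed.

(** Euler's identity. It converts a relation among partial derivatives of homogeneous invariants
    into one among the invariants themselves. *)
Lemma euler_dhomog d p : p \is d.-homog ->
  \sum_(k < n) 'X_k * p^`M(k) = d%:R *: p.
Proof.
move=> /dhomogP hp; rewrite [in RHS](mpolyE p) scaler_sumr.
rewrite {1}(mpolyE p); under eq_bigr do rewrite raddf_sum mulr_sumr /=.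
rewrite exchange_big [LHS]big_seq [RHS]big_seq; apply: eq_bigr => m /hp <- /=.
rewrite scalerA mulrC -scalerA mdegE natr_sum scaler_suml scaler_sumr.
apply: eq_bigr => k _; rewrite mderivZ mderivX -!scalerAr; congr (_ *: _).
have [->|nz] := eqVneq (m k) 0%N; first by rewrite !scale0r.
congr (_ *: _); rewrite -mpolyXD addmC submK //.
by apply/mnm_lepP => l; rewrite mnm1E; case: eqP => // <-; rewrite lt0n.
Qed.

(** If m is split so that q receives a nonzero exponent, the part left to p has degree below that of
    m, where the coefficients of p vanish. *)
Lemma mcoeffM_min p q m :
    (forall m', (mdeg m' < mdeg m)%N -> p@_m' = 0) ->
  (p * q)@_m = p@_m * q@_0.
Proof.
move=> hp; elim/mpolyind: q => [|c m' q _ _ IH].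
  by rewrite mulr0 !mcoeff0 mulr0.
rewrite mulrDr !mcoeffD mulrDr IH; congr (_ + _).
rewrite -scalerAr !mcoeffZ mulrCA; congr (_ * _); rewrite mcoeffX.
have [->|nz] := eqVneq m' 0%MM; first by rewrite mpolyX0 !mulr1.
rewrite mulr0; have [le|nle] := boolP (m' <= m)%MM; last first.
  apply: memN_msupp_eq0; apply: contra nle => /msuppM_le /allpairsP [[m1 m2]]
    /=.
  by rewrite msuppX inE => -[_ /eqP -> ->]; apply: lem_addl.
rewrite -(submK le) addmC mcoeffMX; apply: hp.
rewrite -{2}(submK le) mdegD -[X in (X < _)%N]addn0 ltn_add2l lt0n.
by rewrite mdeg_eq0.
Qed.

End Homogeneous.

(** * The Hilbert ideal and irredundant families of invariants *)

Section Chevalley.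
Variables (K : numFieldType) (n : nat) (T : groupType) (W : {fset T}).
Variable op : T -> {lrmorphism {mpoly K[n]} -> {mpoly K[n]}}.
Hypothesis W_group : group_closed [pred g in W].
Hypothesis op1 : forall p, op 1%g p = p.
Hypothesis opM : forall g h p, op g (op h p) = op (g * h)%g p.
Hypothesis op_linear : forall g i, op g 'X_i \is 1.-homog.
Variable refl : T -> Prop.
Hypothesis refl_div : forall s, s \in W -> refl s ->
  exists2 alpha, alpha \is 1.-homog & forall p, exists q, p - op s p = alpha *
    q.
Hypothesis refl_gen : forall H : {pred T}, group_closed H ->
  (forall g, g \in W -> refl g -> g \in H) -> {subset W <= H}.
Variable c : T -> 'I_n -> 'I_n -> K.
Hypothesis op_deriv : forall g j p,
  (op g p)^`M(j) = \sum_k c g j k *: op g (p^`M(k)).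
Implicit Types (p q a : {mpoly K[n]}) (g h : T).

Local Notation fixed_poly := (fixed_poly W op).
Local Notation avg := (avg W op).

Lemma op_dhomog g d p : p \is d.-homog -> op g p \is d.-homog.
Proof.
move=> /dhomogP hp; rewrite (mpolyE p) linear_sum /= big_seq.
apply: rpred_sum => m /hp <-; rewrite linearZ /=; apply: rpredZ.
rewrite mpolyXE_id rmorph_prod /= mdegE.
elim/big_rec2: _ => [|i d' q _ hq]; first exact: dhomog1.
rewrite rmorphXn /= -[X in (X + _)%N]mul1n; apply: dhomogM hq.
exact/dhomogMn/op_linear.
Qed.

Lemma op_pihomog g d p : pihomog mdeg d (op g p) = op g (pihomog mdeg d p).
Proof.
have -> : op g p = \sum_(i < msize p) op g (pihomog mdeg i p).
  by rewrite {1}(pihomog_partitionE (leqnn (msize p))) linear_sum.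
rewrite linear_sum /=.
have [le|lt] := leqP (msize p) d.
  rewrite big1 => [|i _]; last first.
    apply: (@pihomog_ne0 _ _ _ i); last exact/op_dhomog/pihomogP.
    by rewrite neq_ltn (leq_trans (ltn_ord i) le).
  rewrite pihomogE big1_seq ?rmorph0 // => m /andP [/eqP hm].
  by move/msize_mdeg_lt; rewrite hm ltnNge le.
rewrite (bigD1 (Ordinal lt)) //= big1 ?addr0 => [|i ne].
  by rewrite pihomog_dE //; apply/op_dhomog/pihomogP.
apply: (@pihomog_ne0 _ _ _ i); last exact/op_dhomog/pihomogP.
by apply: contra ne => /eqP e; apply/eqP/val_inj.
Qed.

Lemma op_coeff0 g p : (op g p)@_0 = p@_0.
Proof.
have := op_pihomog g 0 p; rewrite !pihomog0E => /esym.
rewrite -[in op g _](mulr1 (p@_0)%:MP) mul_mpolyC linearZ /= rmorph1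
  -mul_mpolyC.
by rewrite mulr1 => /(congr1 (mcoeff 0%MM)); rewrite !mpolyCK.
Qed.

Lemma op_msize g p : (msize (op g p) <= msize p)%N.
Proof.
rewrite {1}(pihomog_partitionE (leqnn (msize p))) linear_sum /=.
apply: (big_ind (fun q => msize q <= msize p)%N); rewrite ?msize0 //.
  by move=> q r hq hr; apply: leq_trans (msizeD_le _ _) _; rewrite geq_max hq.
move=> i _; apply: leq_trans (ltn_ord i).
exact/msize_dhomog/op_dhomog/pihomogP.
Qed.

(* Combinations of invariants without constant term, with coefficients in A:
   the Hilbert ideal I if A is everything, and mI if A is the ideal m of the
   origin. *)
Inductive coef_ideal (A : {mpoly K[n]} -> Prop) : {mpoly K[n]} -> Prop :=
| coef_ideal0 : coef_ideal A 0
| coef_idealS a q p : A a -> fixed_poly q -> q@_0 = 0 -> coef_ideal A p ->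
    coef_ideal A (a * q + p).

Definition hilbert := coef_ideal (fun=> True).
Definition max_hilbert := coef_ideal (fun a => a@_0 = 0).

Lemma coef_ideal_add A p q : coef_ideal A p -> coef_ideal A q -> coef_ideal A
  (p + q).
Proof. by elim=> [|a r p' Aa ir r0 _ IH] hq; rewrite ?add0r // -addrA;
  apply: coef_idealS (IH hq). Qed.

Lemma coef_ideal_mul (A B : {mpoly K[n]} -> Prop) b p :
  (forall a, A a -> B (b * a)) -> coef_ideal A p -> coef_ideal B (b * p).
Proof.
move=> AB; elim=> [|a q r /AB Ba iq q0 _ IH]; first by rewrite mulr0;
  apply: coef_ideal0.
by rewrite mulrDr mulrA; apply: coef_idealS.
Qed.

Lemma coef_ideal_sum A (I : Type) (r : seq I) (P : pred I) (F : I -> {mpoly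
  K[n]}) :
  (forall i, P i -> coef_ideal A (F i)) -> coef_ideal A (\sum_(i <- r | P i) F
    i).
Proof. by apply: big_ind => [|p q];
  [apply: coef_ideal0 | apply: coef_ideal_add]. Qed.

Lemma hilbertM b p : hilbert p -> hilbert (b * p).
Proof. exact: coef_ideal_mul. Qed.

Lemma hilbertZ b p : hilbert p -> hilbert (b *: p).
Proof. by rewrite -mul_mpolyC; apply: hilbertM. Qed.

Lemma max_hilbertZ b p : max_hilbert p -> max_hilbert (b *: p).
Proof.
by rewrite -mul_mpolyC; apply: coef_ideal_mul => a a0;
  rewrite mcoeffCM a0 mulr0.
Qed.

Lemma hilbert_op g p : g \in W -> hilbert p -> hilbert (op g p).
Proof.
move=> gW; elim=> [|a q r _ iq q0 _ IH]; first by rewrite rmorph0;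
  apply: coef_ideal0.
by rewrite rmorphD rmorphM /= (iq g gW); apply: coef_idealS.
Qed.

Lemma hilbert_invariant p : fixed_poly p -> p@_0 = 0 -> hilbert p.
Proof. by move=> ip p0; rewrite -[p]mul1r -[1 * p]addr0;
  apply: coef_idealS => //; apply: coef_ideal0. Qed.

(** The g in W that fix p modulo the Hilbert ideal form a subgroup, so reflections suffice as a
    test. Then p is the mean of the differences p - g p plus the invariant [avg p], which has no
    constant term. *)
Lemma hilbert_refl p :
    (forall s, s \in W -> refl s -> hilbert (p - op s p)) -> p@_0 = 0 ->
  hilbert p.
Proof.
move=> hs p0; have hW g : g \in W -> hilbert (p - op g p).
  pose H : {pred T} := [pred g | (g \in W) && `[< hilbert (p - op g p) >]].
  suff /(_ g) sub : {subset W <= H} by move=> /sub /andP [_ /asboolP].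
  apply: refl_gen => [|s sW rs]; last by rewrite inE sW; apply/asboolP/hs.
  split=> [|g1 g2]; rewrite !inE.
    by rewrite (memW1 W_group) op1 subrr; apply/asboolP/coef_ideal0.
  move=> /andP [g1W /asboolP h1] /andP [g2W /asboolP h2].
  have g2V := memWV W_group g2W; have g12 := memWM W_group g1W g2V.
  rewrite g12; apply/asboolP.
  have -> : p - op (g1 * g2^-1)%g p =
      p - op g1 p + (-1) *: op (g1 * g2^-1)%g (p - op g2 p).
    rewrite raddfB /= [op _ (op _ _)]opM mulgVK scaleN1r opprB addrA.
    by rewrite subrK.
  by apply: coef_ideal_add => //; apply/hilbertZ/hilbert_op.
have -> : p = (#|` W|%:R)^-1 *: \sum_(g <- W) (p - op g p) + avg p.
  rewrite -scalerDr -big_split /= (eq_bigr (fun=> p)) => [|g _];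
    last by rewrite subrK.
  rewrite big_const_seq count_predT iter_addr_0 -scaler_nat scalerA.
  by rewrite mulVf ?scale1r ?(card_W_neq0 _ W_group).
apply: coef_ideal_add; first by rewrite big_seq;
  apply/hilbertZ/coef_ideal_sum => g; apply: hW.
apply: hilbert_invariant; first exact: avg_invariant.
rewrite mcoeffZ linear_sum big1 ?mulr0 // => g _.
by rewrite /= op_coeff0.
Qed.

(* Chevalley's lemma, in a form where the coefficient functional of a monomial
   of lowest degree replaces the choice of an irredundant subfamily of g. *)
Lemma hilbert_relation r (g h : 'I_r -> {mpoly K[n]}) m :
    (forall i, fixed_poly (g i)) ->
    (forall i m', (mdeg m' < mdeg m)%N -> (g i)@_m' = 0) ->
    \sum_i g i * h i = 0 ->
  hilbert (\sum_i (g i)@_m *: h i).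
Proof.
move=> ig g_min; have [k] : exists k, forall i, (msize (h i) <= k)%N.
  by exists (\max_i msize (h i)) => i;
    exact: (@leq_bigmax _ (fun i => msize (h i))).
(* Induction on a common bound for the sizes of the h i. Applying 1 - s to the relation, for a
   reflection s with linear form alpha, and cancelling alpha replaces each h i by (h i - s (h i)) /
   alpha, of smaller size. *)
elim: k h => [|k IHk] h hk gh0.
  rewrite big1 => [|i _]; first exact: coef_ideal0.
  by have := hk i; rewrite leqn0 msize_poly_eq0 => /eqP ->; rewrite scaler0.
(* The constant term of the combination is the coefficient at m of the vanishing sum of the g i * h
   i, because no g i has a monomial of degree below that of m. *)
apply: hilbert_refl => [s sW rs|]; last first.
  rewrite linear_sum -[RHS](mcoeff0 _ m) -gh0 linear_sum;
    apply: eq_bigr => i _ /=.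
  by rewrite mcoeffZ mcoeffM_min //; apply: g_min.
have [al al1 /choice [D hD]] := refl_div sW rs.
rewrite linear_sum /= -sumrB.
have -> : \sum_i ((g i)@_m *: h i - op s ((g i)@_m *: h i)) =
    al * \sum_i (g i)@_m *: D (h i).
  by rewrite mulr_sumr; apply: eq_bigr => i _;
    rewrite linearZ /= -scalerBr hD scalerAr.
have [->|nz] := eqVneq al 0; first by rewrite mul0r; apply: coef_ideal0.
apply/hilbertM/IHk => [i|]; last first.
  apply: (mulfI nz); rewrite mulr0 mulr_sumr.
  rewrite (eq_bigr (fun i => g i * h i - op s (g i * h i))) => [|i _].
    by have := congr1 (op s) gh0; rewrite linear_sum rmorph0 sumrB gh0 => ->;
      rewrite subr0.
  by rewrite rmorphM /= (ig i s sW) -mulrBr hD mulrCA.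
have [->|nzD] := eqVneq (D (h i)) 0; first by rewrite msize0.
have : (msize (h i - op s (h i)) <= k.+1)%N.
  apply: leq_trans (msizeD_le _ _) _; rewrite msizeN geq_max hk.
  exact: leq_trans (op_msize _ _) (hk i).
(* [msize] is the degree plus one: the nonzero linear form has size 2, so dividing by it lowers the
   size by one. *)
rewrite hD msizeM //.
have -> : msize al = 2; last by [].
by apply/eqP; rewrite -mlead_deg // (dhomog_mf al1) ?mlead_supp.
Qed.

Lemma avg_coeff0 p : (avg p)@_0 = p@_0.
Proof.
rewrite mcoeffZ linear_sum /= (eq_bigr (fun=> p@_0)) => [|g _];
  last exact: op_coeff0.
rewrite big_const_seq count_predT iter_addr_0 -[p@_0 *+ _]mulr_natl mulrA.
by rewrite mulVf ?mul1r ?(card_W_neq0 _ W_group).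
Qed.

(* Homogeneous invariants whose classes are linearly independent in I/mI,
   where I is the Hilbert ideal and m the ideal of the origin; this takes the
   place of a minimal generating family, with no Noetherianity argument. *)
Definition irredundant r (f : 'I_r -> {mpoly K[n]}) :=
  [/\ forall i, fixed_poly (f i),
      forall i, exists2 d, (0 < d)%N & f i \is d.-homog
    & forall b : 'I_r -> K, max_hilbert (\sum_i b i *: f i) ->
        forall i, b i = 0].

(** Let m be a monomial of least degree occurring in the g i, with coefficients c_i. Chevalley's
    lemma puts the sum of the c_i d_k(f_i) in the Hilbert ideal for each k; multiplying by x_k and
    summing over k gives, by Euler's identity, the sum of the c_i deg(f_i) f_i in mI. Irredundance
    forces all c_i to vanish, since the degrees are positive and the characteristic is zero. *)
Lemma irredundant_relation0 r (f g : 'I_r -> {mpoly K[n]}) :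
    irredundant f -> (forall i, fixed_poly (g i)) ->
    (forall k, \sum_i g i * (f i)^`M(k) = 0) ->
  forall i, g i = 0.
Proof.
move=> [_ f_hom f_free] ig gf i0; apply/eqP/negPn/negP => nz.
pose P d := [exists i, has (fun m => mdeg m == d) (msupp (g i))].
have exP : exists d, P d.
  exists (mdeg (mlead (g i0))); apply/existsP; exists i0; apply/hasP.
  by exists (mlead (g i0)); rewrite ?mlead_supp.
case: (ex_minnP exP) => e /existsP [i1 /hasP [m m_supp /eqP em]] e_min.
have g_min i m' : (mdeg m' < mdeg m)%N -> (g i)@_m' = 0.
  rewrite em => lt; apply: memN_msupp_eq0; apply: contraL lt => m'_supp.
  rewrite -leqNgt; apply: e_min; apply/existsP; exists i; apply/hasP.
  by exists m'.
have /choice [d f_d] : forall i, exists d, (0 < d)%N /\ f i \is d.-homog.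
  by move=> i; have [d d0 fd] := f_hom i; exists d.
suff /f_free /(_ i1) /eqP :
    max_hilbert (\sum_i ((g i)@_m * (d i)%:R) *: f i).
  rewrite mulf_eq0 pnatr_eq0 mcoeff_eq0 m_supp /=.
  by case: (f_d i1); rewrite lt0n => /negPf ->.
have -> : \sum_i ((g i)@_m * (d i)%:R) *: f i =
    \sum_k 'X_k * \sum_i (g i)@_m *: (f i)^`M(k).
  under [RHS]eq_bigr do rewrite mulr_sumr.
  rewrite exchange_big; apply: eq_bigr => i _ /=.
  rewrite -scalerA -euler_dhomog ?scaler_sumr; last by case: (f_d i).
  by apply: eq_bigr => k _; rewrite scalerAr.
apply: coef_ideal_sum => k _; have := hilbert_relation ig g_min (gf k).
by apply: coef_ideal_mul => a _;
  rewrite rmorphM /= (@dhomog_coeff0 _ _ 1) ?mul0r // dhomogX /= mdeg1.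
Qed.

(** Reduction to invariant coefficients. Multiplying by the images of g i0 under the nontrivial
    elements of W turns that coefficient into its norm. By the chain rule [op_deriv] and the
    invariance of the f i, every conjugate of the relation is a relation again, so averaging gives
    one with invariant coefficients, in which the norm is unchanged. *)
Lemma irredundant_relation r (f g : 'I_r -> {mpoly K[n]}) :
    irredundant f -> (forall k, \sum_i g i * (f i)^`M(k) = 0) ->
  forall i, g i = 0.
Proof.
move=> gd gf i0; apply/eqP; apply/negPn/negP => nz; have [fi _ _] := gd.
pose h := \prod_(w <- rem 1%g (enum_fset W)) op w (g i0).
have hg : h * g i0 = \prod_(w <- W) op w (g i0).
  by rewrite (big_rem 1%g (memW1 W_group)) /= op1 mulrC.
have gh_inv : fixed_poly (h * g i0) by rewrite hg => w; apply: op_prodW.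
have /(_ i0) : forall i, avg (h * g i) = 0.
  apply: irredundant_relation0 gd _ _ => [i|k]; first exact: avg_invariant.
  have gfW w : w \in W -> \sum_i op w (h * g i) * (f i)^`M(k) = 0.
    move=> wW; transitivity (\sum_l c w k l *: op w (h * \sum_i g i * (f
      i)^`M(l))).
      under [RHS]eq_bigr do rewrite mulr_sumr linear_sum scaler_sumr.
      rewrite exchange_big; apply: eq_bigr => i _ /=.
      rewrite -{1}(fi i w wW) op_deriv mulr_sumr; apply: eq_bigr => l _.
      by rewrite mulrA [op w (_ * _^`M(_))]rmorphM scalerAr.
    by rewrite big1 // => l _; rewrite gf mulr0 rmorph0 scaler0.
  transitivity ((#|` W|%:R)^-1 *: \sum_(w <- W) \sum_i op w (h * g i) * (f
    i)^`M(k)).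
    rewrite exchange_big scaler_sumr; apply: eq_bigr => i _ /=.
    by rewrite -mulr_suml scalerAl.
  by rewrite big_seq big1 ?scaler0 // => w; apply: gfW.
rewrite (avg_id W_group gh_inv) hg => /eqP;
  rewrite prodf_seq_eq0 => /hasP [w wW /=].
rewrite -(rmorph0 (op w)) (can_eq (g := op w^-1%g)) ?(negPf nz) //.
by move=> p; rewrite opM mulVg op1.
Qed.

(** The Jacobian matrix has n columns, and its rows are independent over the fraction field. *)
Lemma irredundant_leq r (f : 'I_r -> {mpoly K[n]}) : irredundant f -> (r <=
  n)%N.
Proof.
move=> gd; pose J := \matrix_(i < r, k < n) (f i)^`M(k).
suff /eqP <- : row_free (map_mx (@tofrac _) J) by apply: rank_leq_col.
apply: row_free_tofrac => g gJ; apply: irredundant_relation gd _ => k.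
by rewrite -[RHS](gJ k); apply: eq_bigr => i _; rewrite mxE.
Qed.

(** The bound on lengths gives a longest irredundant family. A homogeneous invariant outside its
    span modulo mI could be adjoined to it without losing irredundance. *)
Lemma exists_maximal_irredundant : exists r (f : 'I_r -> {mpoly K[n]}),
  irredundant f /\
  forall d q, (0 < d)%N -> q \is d.-homog -> fixed_poly q ->
    exists b, max_hilbert (q - \sum_i b i *: f i).
Proof.
pose P r := `[< exists f : 'I_r -> {mpoly K[n]}, irredundant f >].
have exP : exists r, P r.
  by exists 0%N; apply/asboolP; exists (fun=> 0); split=> [[]|[]|b _ []].
have leP r : P r -> (r <= n)%N by move=> /asboolP [f]; apply: irredundant_leq.
case: (ex_maxnP exP leP) => r /asboolP [f gd] r_max.
exists r, f; split=> // d q d0 qd qi; apply: contrapT => nex.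
have [fi fh ffree] := gd.
pose f' (i : 'I_r.+1) := if unlift ord0 i is Some j then f j else q.
suff /r_max : P r.+1 by rewrite ltnn.
apply/asboolP; exists f'; split=> [i|i|b].
- by rewrite /f'; case: unliftP.
- by rewrite /f'; case: unliftP => [j _|_]; [apply: fh | exists d].
rewrite big_ord_recl {1}/f' unlift_none => hb.
have hb' : max_hilbert (b ord0 *: q + \sum_i b (lift ord0 i) *: f i).
  by congr (max_hilbert (_ + _)): hb; apply: eq_bigr => i _; rewrite /f' liftK.
have b0 : b ord0 = 0.
  apply/eqP/negPn/negP => nz; apply: nex.
  exists (fun i => - (b ord0)^-1 * b (lift ord0 i)).
  have := max_hilbertZ (b ord0)^-1 hb'; congr max_hilbert.
  rewrite scalerDr scalerA mulVf // scale1r; congr (_ + _).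
  rewrite scaler_sumr -sumrN; apply: eq_bigr => i _.
  by rewrite scalerA mulNr scaleNr opprK.
move=> i; case: (unliftP ord0 i) => [j ->|-> //].
by move: hb'; rewrite b0 scale0r add0r => /ffree.
Qed.

Lemma pihomogM_sum N d p q : (msize p <= N)%N -> (msize q <= N)%N ->
  pihomog mdeg d (p * q) = \sum_(i < N) \sum_(j < N | (i + j == d)%N)
    pihomog mdeg i p * pihomog mdeg j q.
Proof.
move=> hp hq; rewrite {1}(pihomog_partitionE hp) {1}(pihomog_partitionE hq).
rewrite mulr_suml linear_sum; apply: eq_bigr => i _ /=.
rewrite mulr_sumr linear_sum [RHS]big_mkcond; apply: eq_bigr => j _ /=.
have hij := dhomogM (pihomogP mdeg i p) (pihomogP mdeg j q).
by case: eqP => [<-|/eqP ne]; [rewrite pihomog_dE | rewrite (pihomog_ne0 ne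
  hij)].
Qed.

Lemma pihomog_invariant d p : fixed_poly p -> fixed_poly (pihomog mdeg d p).
Proof. by move=> ip g gW; rewrite -op_pihomog ip. Qed.

(** * Generation of the invariant ring by a maximal irredundant family *)

Section Generation.
Variables (r : nat) (f : 'I_r -> {mpoly K[n]}).
Hypothesis f_irredundant : irredundant f.
Hypothesis f_max : forall d q, (0 < d)%N -> q \is d.-homog -> fixed_poly q ->
    exists b, max_hilbert (q - \sum_i b i *: f i).

Definition generated q := exists P, q = P \mPo [tuple f i | i < r].

Lemma generatedC (b : K) : generated b%:MP.
Proof. by exists b%:MP; rewrite comp_mpolyC. Qed.
Lemma generated_var i : generated (f i).
Proof. by exists 'X_i; rewrite comp_mpolyXU -tnth_nth tnth_mktuple. Qed.
Lemma generatedD p q : generated p -> generated q -> generated (p + q).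
Proof. by move=> [P ->] [Q ->]; exists (P + Q); rewrite raddfD. Qed.
Lemma generatedM p q : generated p -> generated q -> generated (p * q).
Proof. by move=> [P ->] [Q ->]; exists (P * Q); rewrite rmorphM. Qed.
Lemma generated_sum (I : Type) (s : seq I) (P : pred I) (F : I -> {mpoly K[n]})
  :
  (forall i, P i -> generated (F i)) -> generated (\sum_(i <- s | P i) F i).
Proof.
by apply: big_ind => [|p q]; [rewrite -mpolyC0;
  apply: generatedC | apply: generatedD].
Qed.

(** Strong induction on the degree. Modulo mI, q is a combination of the f i. Averaging makes the
    coefficients of the remainder invariant and keeps their constant terms zero, so its component of
    degree d is a sum of products of two invariants of positive degree, both therefore of degree
    less than d. *)
Lemma homog_generated d q : q \is d.-homog -> fixed_poly q -> generated q.
Proof.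
elim/ltn_ind: d q => d IHd q qd qi.
have [d0|d0] := posnP d.
  by move: qd; rewrite d0 => /pihomog_dE <-; rewrite pihomog0E;
    apply: generatedC.
have [b qb] := f_max d0 qd qi; have [fi fh _] := f_irredundant.
have -> : q = \sum_i b i *: pihomog mdeg d (f i) +
    pihomog mdeg d (avg (q - \sum_i b i *: f i)).
  have -> : avg (q - \sum_i b i *: f i) = q - \sum_i b i *: f i.
    rewrite linearB /= (avg_id W_group qi) linear_sum; congr (_ - _).
    by apply: eq_bigr => i _; rewrite linearZ /= (avg_id W_group (fi i)).
  have <- : pihomog mdeg d (\sum_i b i *: f i) = \sum_i b i *: pihomog mdeg d
    (f i).
    by rewrite linear_sum; apply: eq_bigr => i _; rewrite linearZ.
  by rewrite linearB /= (pihomog_dE qd) addrC subrK.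
apply: generatedD.
  apply: generated_sum => i _; rewrite -mul_mpolyC; apply: generatedM;
    first exact: generatedC.
  have [e e0 fe] := fh i; have [<-|ne] := eqVneq e d.
    by rewrite pihomog_dE //; apply: generated_var.
  by rewrite (pihomog_ne0 ne fe) -mpolyC0; apply: generatedC.
elim: qb => [|a p z a0 ip p0 _ IHz]; first by rewrite !linear0 -mpolyC0;
  apply: generatedC.
rewrite linearD /= avgMl // raddfD /=; apply: generatedD => //.
set a' := avg a; have a'0 : a'@_0 = 0 by rewrite avg_coeff0.
have ia' : fixed_poly a' by apply: avg_invariant.
rewrite (@pihomogM_sum (maxn (msize a') (msize p))) ?leq_maxl ?leq_maxr //.
apply: generated_sum => i _; apply: generated_sum => j /eqP ij.
have gen0 : generated 0 by rewrite -mpolyC0; apply: generatedC.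
have [i0|i0] := posnP i; first by rewrite i0 pihomog0E a'0 mpolyC0 mul0r.
have [j0|j0] := posnP j; first by rewrite j0 pihomog0E p0 mpolyC0 mulr0.
apply: generatedM.
  apply: (IHd i); [|exact: pihomogP|exact: pihomog_invariant].
  by rewrite -ij -[X in (X < _)%N]addn0 ltn_add2l.
apply: (IHd j); [|exact: pihomogP|exact: pihomog_invariant].
by rewrite -ij -[X in (X < _)%N]add0n ltn_add2r.
Qed.

Lemma invariant_generated q : fixed_poly q -> generated q.
Proof.
move=> iq; rewrite (pihomog_partitionE (leqnn (msize q))).
by apply: generated_sum => i _; apply: homog_generated (pihomogP _ _ _) _;
  apply: pihomog_invariant.
Qed.

End Generation.

(** This monic polynomial with invariant coefficients makes x_j integral over the invariants; its
    degree, the order of W, later bounds the exponents of the spanning monomials. *)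
Definition orbit_poly j : {poly {mpoly K[n]}} :=
  \prod_(w <- W) ('X - (op w 'X_j)%:P).

Lemma orbit_poly_monic j : orbit_poly j \is monic.
Proof. exact: monic_prod_XsubC. Qed.

Lemma size_orbit_poly j : size (orbit_poly j) = (#|` W|).+1.
Proof. by rewrite size_prod_XsubC. Qed.

Lemma orbit_poly_coef_invariant j i : fixed_poly (orbit_poly j)`_i.
Proof.
move=> w wW; suff e : map_poly (op w) (orbit_poly j) = orbit_poly j by rewrite
  -coef_map /= e.
rewrite rmorph_prod /orbit_poly -[RHS](perm_big _ (perm_mulW W_group wW))
  big_map.
by apply: eq_bigr => g _; rewrite rmorphB /= map_polyX map_polyC /= opM.
Qed.

Lemma orbit_poly_root j : (orbit_poly j).['X_j] = 0.
Proof.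
rewrite /orbit_poly -(big_map (fun w => op w 'X_j) predT (fun b => 'X - b%:P)).
apply/rootP; rewrite root_prod_XsubC.
by apply/mapP; exists 1%g; rewrite ?op1 ?(memW1 W_group).
Qed.

(** * Derivations vanishing on the invariants *)

Section ColumnIndependence.
Variables (r : nat) (f : 'I_r -> {mpoly K[n]}).
Hypothesis f_gen : forall q, fixed_poly q -> generated f q.
Variable a : 'I_n -> {mpoly K[n]}.
Hypothesis af : forall i, \sum_k a k * (f i)^`M(k) = 0.

Let D p : {mpoly K[n]} := \sum_k a k * p^`M(k).

Let DD p q : D (p + q) = D p + D q.
Proof. by rewrite /D -big_split; apply: eq_bigr => k _;
  rewrite mderivD mulrDr. Qed.

Let DM p q : D (p * q) = D p * q + p * D q.
Proof.
rewrite /D mulr_suml mulr_sumr -big_split; apply: eq_bigr => k _ /=.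
by rewrite mderivM mulrDr !mulrA [p * a k]mulrC.
Qed.

Let DC (b : K) : D b%:MP = 0.
Proof. by rewrite /D big1 // => k _; rewrite mderivC mulr0. Qed.

Let DX j : D 'X_j = a j.
Proof.
rewrite /D (bigD1 j) //= big1 ?addr0 => [|k ne]; rewrite mderivX mnm1E.
  by rewrite eqxx scale1r -[X in (X - _)%MM]add0m addmK mpolyX0 mulr1.
by rewrite eq_sym (negPf ne) scale0r mulr0.
Qed.

Let D_invariant q : fixed_poly q -> D q = 0.
Proof.
move=> /f_gen [P ->]; elim/mpolyind: P => [|b m P _ _ IH].
  by rewrite comp_mpoly0 -mpolyC0 DC.
rewrite comp_mpolyD DD IH addr0 comp_mpolyZ -mul_mpolyC DM DC mul0r add0r
  comp_mpolyX.
suff -> : D (\prod_i tnth [tuple f i  | i < r] i ^+ m i) = 0 by rewrite mulr0.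
elim/big_rec: _ => [|i p _ Dp]; first by rewrite -mpolyC1 DC.
rewrite DM Dp mulr0 addr0 tnth_mktuple.
suff -> : D (f i ^+ m i) = 0 by rewrite mul0r.
elim: (m i) => [|k IHk]; first by rewrite expr0 -mpolyC1 DC.
by rewrite exprS DM IHk mulr0 addr0 [D _]af mul0r.
Qed.

Let D_horner (Q : {poly {mpoly K[n]}}) x : (forall i, D Q`_i = 0) ->
  D Q.[x] = Q^`().[x] * D x.
Proof.
elim/poly_ind: Q => [|Q b IH] DQ;
  first by rewrite deriv0 !horner0 -mpolyC0 DC mpolyC0 mul0r.
have Db : D b = 0 by have := DQ 0; rewrite coefD coefMX coefC add0r.
rewrite derivD derivM derivX derivC addr0 mulr1 !hornerE DD Db addr0 DM IH.
  by rewrite mulrDl mulrAC.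
by move=> i; have := DQ i.+1; rewrite coefD coefMX coefC addr0.
Qed.

(** The derivation D kills the f i, hence all invariants. For a nonzero Q of least size with
    invariant coefficients and root x_j, one gets 0 = D(Q(x_j)) = Q'(x_j) a_j, and Q'(x_j) is
    nonzero by minimality. In matrix terms, the columns of the Jacobian are independent. *)
Lemma generated_derivation0 j : a j = 0.
Proof.
pose P d := `[< exists Q : {poly {mpoly K[n]}}, [/\ Q != 0, size Q = d,
  forall i, fixed_poly Q`_i & Q.['X_j] = 0] >].
have exP : exists d, P d.
  exists (size (orbit_poly j)); apply/asboolP; exists (orbit_poly j).
  split=> //; [exact/monic_neq0/orbit_poly_monic | | exact: orbit_poly_root].
  exact: orbit_poly_coef_invariant.
case: (ex_minnP exP) => d /asboolP [Q [nzQ sQ iQ Q0]] d_min.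
have := congr1 D Q0; rewrite D_horner => [|i]; last exact: D_invariant.
rewrite DX -mpolyC0 DC => /eqP; rewrite mulf_eq0 => /orP [|/eqP //].
move/eqP => Q'0.
(* A nonzero constant has no root, so Q has positive degree and Q' is nonzero in characteristic
   zero. *)
have [k sk] : exists k, size Q = k.+2.
  move: (Q0); case sQ': (size Q) => [|[|k]] //; last by exists k.
    by move/eqP: sQ'; rewrite size_poly_eq0 (negPf nzQ).
  have /size1_polyC -> : (size Q <= 1)%N by rewrite sQ'.
  move=> Qc; exfalso; move: nzQ Qc => /negP nzQ; rewrite hornerC => Qc;
    apply: nzQ.
  by rewrite (size1_polyC (_ : size Q <= 1)%N) ?sQ' // Qc.
have nzQ' : Q^`() != 0.
  apply/eqP => /(congr1 (fun q : {poly _} => q`_k)); rewrite coef_deriv coef0.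
  move/eqP; rewrite -scaler_nat scaler_eq0 pnatr_eq0 /=.
  have -> : k.+1 = (size Q).-1 by rewrite sk.
  by rewrite -lead_coefE lead_coef_eq0 (negPf nzQ).
have : P (size Q^`()).
  apply/asboolP; exists Q^`(); split=> // i; rewrite coef_deriv => g gW.
  by rewrite rmorphMn /= iQ.
by move/d_min; rewrite leqNgt -sQ lt_size_deriv.
Qed.

End ColumnIndependence.

Lemma reflection_invariants : exists f : 'I_n -> {mpoly K[n]},
  [/\ forall i, fixed_poly (f i),
      forall q, fixed_poly q -> generated f q
    & \det (\matrix_(i, k) (f i)^`M(k)) != 0].
Proof.
have [r [f [f_irredundant f_max]]] := exists_maximal_irredundant.
have f_gen q := invariant_generated f_irredundant f_max (q := q).
pose J := \matrix_(i < r, k < n) (f i)^`M(k).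
have J_free : row_free (map_mx (@tofrac _) J).
  apply: row_free_tofrac => g gJ;
    apply: irredundant_relation f_irredundant _ => k.
  by rewrite -[RHS](gJ k); apply: eq_bigr => i _; rewrite mxE.
have JT_free : row_free (map_mx (@tofrac _) J^T).
  apply: row_free_tofrac => a aJ j;
    apply: (generated_derivation0 f_gen (a := a)) => i.
  by rewrite -[RHS](aJ i); apply: eq_bigr => k _; rewrite !mxE.
have rn : r = n.
  move: J_free JT_free; rewrite /row_free -map_trmx mxrank_tr => /eqP -> /eqP.
  by [].
subst r; have [fi _ _] := f_irredundant.
exists f; split=> //; rewrite -tofrac_eq0 -det_map_mx.
by move: J_free; rewrite row_free_unit unitmxE unitfE.
Qed.

End Chevalley.

(** Since p p' - phi(p) phi(p') = (p - phi(p)) p' + phi(p) (p' - phi(p')), divisibility has to be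
    checked on the variables only. *)
Lemma mpoly_morph_div (K : comNzRingType) n
    (phi : {lrmorphism {mpoly K[n]} -> {mpoly K[n]}}) al :
    (forall j, exists q, 'X_j - phi 'X_j = al * q) ->
  forall p, exists q, p - phi p = al * q.
Proof.
move=> dX.
have dC (b : K) : exists q, b%:MP - phi b%:MP = al * q.
  by exists 0; rewrite -[b%:MP]mulr1 mul_mpolyC linearZ /= rmorph1 mulr0 subrr.
have dD p p' : (exists q, p - phi p = al * q) ->
    (exists q, p' - phi p' = al * q) ->
    exists q, (p + p') - phi (p + p') = al * q.
  by move=> [q hq] [q' hq']; exists (q + q');
    rewrite mulrDr -hq -hq' rmorphD /= opprD addrACA.
have dM p p' : (exists q, p - phi p = al * q) ->
    (exists q, p' - phi p' = al * q) ->
    exists q, p * p' - phi (p * p') = al * q.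
  move=> [q hq] [q' hq']; exists (q * p' + phi p * q').
  by rewrite mulrDr mulrA -hq mulrCA -hq' rmorphM /= mulrBl mulrBr addrA subrK.
elim/mpolyind => [|b m p _ _ IH]; first by rewrite -mpolyC0; apply: (dC).
apply: (dD) => //; rewrite -mul_mpolyC; apply: (dM); first exact: dC.
rewrite mpolyXE_id; elim/big_rec: _ => [|i p' _ IH'];
  first by rewrite -mpolyC1; apply: (dC).
apply: (dM) => //; elim: (m i) => [|k IHk]; first by rewrite expr0 -mpolyC1;
  apply: (dC).
by rewrite exprS; apply: (dM).
Qed.

(** * Complex reflections acting on polynomials *)

Section ReflectionGroup.
Variables (K : numFieldType) (V : vectType K) (n : nat) (e : n.-tuple V).
Hypothesis he : basis_of {:V} e.

Definition GLop (g : GL V) : {lrmorphism {mpoly K[n]} -> {mpoly K[n]}} :=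
  GLact e g.

(** The operator g^-1 - 1 kills a hyperplane, so its image has dimension at most one, and u spans
    it. *)
Lemma reflection_rank1 (g : GL V) : complex_reflection g ->
  exists u : V, forall v, exists a : K, (g^-1)%g v = v + a *: u.
Proof.
move=> [_ [H [dimH fixH]]]; pose N : 'End(V) := Defs.GLval (g^-1)%g - \1%VF.
have HN : (H <= lker N)%VS.
  apply/subvP => v vH; rewrite memv_ker !lfun_simp /= subr_eq0.
  by rewrite -{1}(fixH v vH) GLVK.
have dimN : (\dim (limg N) <= 1)%N.
  have := limg_ker_dim N fullv; rewrite capfv => dN.
  by rewrite -(leq_add2l (\dim (lker N))) dN addn1 -dimH ltnS dimvS.
have [u Nu] : exists u, (limg N <= <[u]>)%VS.
  exists (vpick (limg N)); have [->|nz] := eqVneq (limg N) 0%VS;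
    first exact: sub0v.
  have le : (<[vpick (limg N)]> <= limg N)%VS by rewrite -memvE memv_pick.
  by rewrite -(geq_leqif (dimv_leqif_sup le)) dim_vline vpick0 nz.
exists u => v; have /vlineP [a Nv] : N v \in <[u]>%VS.
  by apply: (subvP Nu); rewrite memv_img ?memvf.
by exists a; rewrite -Nv !lfun_simp /= addrC subrK.
Qed.

Lemma reflection_div (g : GL V) : complex_reflection g ->
  exists2 alpha, alpha \is 1.-homog &
    forall p : {mpoly K[n]}, exists q, p - GLop g p = alpha * q.
Proof.
move=> /reflection_rank1 [u /choice [a ga]].
(* [a] is a mere choice of coefficients, not known to be linear; the form is built from its values
   on the basis. *)
pose al : {mpoly K[n]} := \sum_(i < n) a e`_i *: 'X_i.
exists al; first by apply: rpred_sum => i _; rewrite rpredZ // dhomogX /= mdeg1.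
apply: mpoly_morph_div => j; exists (- (coord e j u))%:MP;
  rewrite /= GLactX mulrC mul_mpolyC scaleNr.
rewrite (eq_bigr (fun i : 'I_n => (i == j)%:R *: 'X_i + coord e j u *: (a e`_i
  *: 'X_i))) => [|i _].
  rewrite big_split /= -scaler_sumr (bigD1 j) //= eqxx scale1r big1 ?addr0 =>
    [|i /negPf ->].
    by rewrite opprD addrA subrr add0r.
  by rewrite scale0r.
rewrite ga linearD linearZ /= coord_free ?(basis_free he) // scalerDl mulrC
  scalerA.
by rewrite eq_sym.
Qed.

Variable W : {fset GL V}.
Hypothesis hW : complex_reflection_group W.

Lemma GLop1 p : GLop 1%g p = p. Proof. exact: GLact1. Qed.
Lemma GLopM g h p : GLop g (GLop h p) = GLop (g * h)%g p.
Proof. exact: GLact_comp. Qed.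

Lemma complex_reflection_invariants : exists f : 'I_n -> {mpoly K[n]},
  [/\ forall i, fixed_poly W GLop (f i),
      forall q, fixed_poly W GLop q -> generated f q
    & \det (\matrix_(i, k) (f i)^`M(k)) != 0].
Proof.
case: hW => W_group W_gen.
apply: (reflection_invariants W_group GLop1 GLopM _ _ W_gen).
- move=> g i; rewrite /= GLactX; apply: rpred_sum => k _.
  by rewrite rpredZ // dhomogX /= mdeg1.
- by move=> s _; apply: reflection_div.
- by move=> g j p; apply: GLact_deriv.
Qed.

End ReflectionGroup.

(** * Presentation of the Weyl algebra *)

Definition mk_lrmorphism (K : pzRingType) (A B : algType K) (f : A -> B)
    (lf : linear f) (mf : monoid_morphism f) : {lrmorphism A -> B} :=
  HB.pack f (GRing.isLinear.Build K A B *:%R f lf)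
    (GRing.isMonoidMorphism.Build A B f mf).

Section OrderedProduct.
Variables (R : nzRingType) (I : eqType) (h : I -> R).
Implicit Types (s : seq I) (a : I -> nat).

Lemma prod_mull_comm s a i :
    (forall j, h i * h j = h j * h i) -> uniq s -> i \in s ->
  h i * \prod_(j <- s) h j ^+ a j = \prod_(j <- s) h j ^+ (a j + (i == j)).
Proof.
move=> hC; elim: s => // j s IH /= /andP [js us]; rewrite inE !big_cons.
case: eqVneq => [e|ne /= si].
  move=> _; rewrite -e in js *; rewrite mulrA -exprS addn1; congr (_ * _).
  rewrite [LHS]big_seq [RHS]big_seq; apply: eq_bigr => l sl.
  by case: eqVneq => [e'|]; [rewrite -e' (negPf js) in sl | rewrite addn0].
by rewrite addn0 -IH // !mulrA; congr (_ * _); apply: commrX.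
Qed.

(** D takes only the central values 0 and 1 on the factors, so the power rule holds although the
    factors need not commute. *)
Lemma prod_derivation (D : {additive R -> R}) s a i :
    (forall x y, D (x * y) = D x * y + x * D y) ->
    (forall j, D (h j) = (i == j)%:R) -> uniq s ->
  D (\prod_(j <- s) h j ^+ a j) =
    (if i \in s then \prod_(j <- s) h j ^+ (a j - (i == j)) else 0) *+ a i.
Proof.
move=> DM Dh.
have D1 : D 1 = 0 by apply: (addrI (D 1));
  rewrite addr0 -{3}[1]mulr1 DM mulr1 mul1r.
have DX j k : D (h j ^+ k) = (if i == j then h j ^+ k.-1 else 0) *+ k.
  elim: k => [|k IH]; first by rewrite expr0 D1 mulr0n.
  rewrite exprS DM IH Dh; case: eqP => _;
    last by rewrite mul0r mul0rn mulr0 add0r mul0rn.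
  rewrite mul1r mulrnAr [RHS]mulrS; congr (_ + _).
  by case: k {IH} => [|k]; rewrite ?mulr0n // -exprS.
elim: s => [|j s IH] /=; first by rewrite big_nil D1 mul0rn.
move=> /andP [js us]; rewrite !big_cons DM IH // DX inE.
case: eqVneq => [e|ne] /=; last first.
  rewrite mul0rn mul0r add0r; case: ifP => _; last by rewrite !mul0rn mulr0.
  by rewrite mulrnAr subn0.
rewrite -e in js *; rewrite (negPf js) mul0rn mulr0 addr0 mulrnAl subn1.
congr (_ * _ *+ _); rewrite [LHS]big_seq [RHS]big_seq; apply: eq_bigr => l sl.
by case: eqVneq => [e'|]; [rewrite -e' (negPf js) in sl | rewrite subn0].
Qed.

End OrderedProduct.

Section NormalOrdering.
Variables (K : numFieldType) (n : nat) (B : algType K) (X P : 'I_n -> B).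
Hypothesis XC : forall i j, X i * X j = X j * X i.
Hypothesis PC : forall i j, P i * P j = P j * P i.
Hypothesis PX : forall i j, P i * X j - X j * P i = (i == j)%:R.

Let h (k : 'I_(n + n)) := match split k with inl i => X i | inr i => P i end.

Let hl i : h (lshift n i) = X i. Proof. by rewrite /h (unsplitK (inl i)). Qed.
Let hr i : h (rshift n i) = P i. Proof. by rewrite /h (unsplitK (inr i)). Qed.

(** The product of a monomial runs through the indices in increasing order, so every X stands to the
    left of every P. The map is linear but not multiplicative. *)
Definition normal_ordering (p : {mpoly K[n + n]}) : B := mmap (in_alg B) h p.
Local Notation T := normal_ordering.

Lemma normal_ordering_is_linear : linear T.
Proof.
move=> a p q; rewrite /T mmapD mmapZ; congr (_ + _).
by rewrite /= mulr_algl.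
Qed.
HB.instance Definition _ := GRing.isLinear.Build K _ _ _ T
  normal_ordering_is_linear.

Lemma normal_orderingX m : T 'X_[m] = \prod_k h k ^+ m k.
Proof. by rewrite /T mmapX. Qed.

Lemma normal_ordering1 : T 1 = 1.
Proof. by rewrite -mpolyX0 normal_orderingX big1 // => k _; rewrite mnm0E. Qed.

Lemma normal_ordering_mulX i p : X i * T p = T ('X_(lshift n i) * p).
Proof.
elim/mpolyind: p => [|c m p _ _ IH]; first by rewrite mulr0 !linear0 mulr0.
rewrite mulrDr !linearD /= mulrDr IH; congr (_ + _).
rewrite -scalerAr !linearZ /= -scalerAr; congr (_ *: _).
rewrite -mpolyXD !normal_orderingX !big_split_ord /= mulrA; congr (_ * _).
  rewrite (eq_bigr (fun j => X j ^+ m (lshift n j))) => [|j _];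
    last by rewrite hl.
  rewrite prod_mull_comm ?index_enum_uniq ?mem_index_enum //.
  by apply: eq_bigr => j _; rewrite hl mnmDE mnm1E eq_lshift addnC.
by apply: eq_bigr => j _; rewrite mnmDE mnm1E eq_lrshift.
Qed.

Lemma normal_ordering_mulP i p : T p * P i = T (p * 'X_(rshift n i)).
Proof.
elim/mpolyind: p => [|c m p _ _ IH]; first by rewrite mul0r !linear0 mul0r.
rewrite mulrDl !linearD /= mulrDl IH; congr (_ + _).
rewrite -scalerAl !linearZ /= -scalerAl; congr (_ *: _).
rewrite -mpolyXD !normal_orderingX !big_split_ord /= -mulrA; congr (_ * _).
  by apply: eq_bigr => j _; rewrite mnmDE mnm1E eq_rlshift addn0.
rewrite (eq_bigr (fun j => P j ^+ m (rshift n j))) => [|j _];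
  last by rewrite hr.
have <- : P i * \prod_(j < n) P j ^+ m (rshift n j) =
    (\prod_(j < n) P j ^+ m (rshift n j)) * P i.
  by apply: commr_prod => j _; apply: commrX; apply: PC.
rewrite prod_mull_comm ?index_enum_uniq ?mem_index_enum //.
by apply: eq_bigr => j _; rewrite hr mnmDE mnm1E eq_rshift.
Qed.

(** Applied below to commutators with the P i and the X i, which thereby realize the formal partial
    derivatives inside B. *)
Lemma normal_ordering_derivation (D : {linear B -> B}) k p :
    (forall x y, D (x * y) = D x * y + x * D y) ->
    (forall j, D (h j) = (k == j)%:R) ->
  D (T p) = T p^`M(k).
Proof.
move=> DM Dh; elim/mpolyind: p => [|c m p _ _ IH]; first by rewrite !linear0.
rewrite !linearD /= IH; congr (_ + _); rewrite !linearZ /=; congr (_ *: _).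
rewrite mderivX linearZ /= scaler_nat !normal_orderingX.
rewrite (prod_derivation _ DM Dh) ?index_enum_uniq // mem_index_enum.
by congr (_ *+ _); apply: eq_bigr => j _; rewrite mnmBE mnm1E.
Qed.

Let ad (b : B) (x : B) := b * x - x * b.
Let ad_linear b : linear (ad b).
Proof.
by move=> a x y; rewrite /ad mulrDr mulrDl -scalerAr -scalerAl scalerBr opprD
  addrACA.
Qed.
HB.instance Definition _ b := GRing.isLinear.Build K _ _ _ (ad b) (ad_linear b).
Let adM b x y : ad b (x * y) = ad b x * y + x * ad b y.
Proof. by rewrite /ad mulrBl mulrBr !mulrA addrA subrK. Qed.

Lemma normal_ordering_adP i p : P i * T p - T p * P i = T p^`M(lshift n i).
Proof.
apply: (@normal_ordering_derivation (ad (P i))) => [|j]; first exact: adM.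
rewrite -(splitK j); case: (split j) => k /=.
  by rewrite hl eq_lshift; apply: PX.
by rewrite hr eq_lrshift /= /ad PC subrr.
Qed.

Lemma normal_ordering_adX i p : T p * X i - X i * T p = T p^`M(rshift n i).
Proof.
pose D : {linear B -> B} := (-%R \o ad (X i))%FUN.
have DE x : D x = x * X i - X i * x by rewrite /= opprB.
rewrite -DE; apply: (@normal_ordering_derivation D) => [x y|j].
  by rewrite /= adM opprD mulNr mulrN.
rewrite DE -(splitK j); case: (split j) => k /=.
  by rewrite hl eq_rlshift XC subrr.
by rewrite hr eq_rshift PX eq_sym.
Qed.

Lemma normal_ordering_mulPl i p :
  P i * T p = T (p * 'X_(rshift n i) + p^`M(lshift n i)).
Proof. by rewrite linearD /= -normal_ordering_mulP -normal_ordering_adP addrC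
  subrK. Qed.

(** The kernel is stable under all partial derivatives, since commutators with the X i and P i
    induce them. They lower the size, so by induction the derivatives of a kernel element vanish; in
    characteristic zero it is then a constant, and nonzero constants are not sent to 0. *)
Lemma normal_ordering_inj : injective T.
Proof.
suff T0 p : T p = 0 -> p = 0.
  move=> p q /eqP; rewrite -subr_eq0 -linearB /= => /eqP /T0 /eqP.
  by rewrite subr_eq0 => /eqP.
have [k] := ubnP (msize p); elim: k p => // k IHk p pk Tp.
have dp i : p^`M(i) = 0.
  have [->|nz] := eqVneq p 0; first exact: raddf0.
  apply: IHk; last first.
    rewrite -(splitK i); case: (split i) => j /=.
      by rewrite -normal_ordering_adP Tp mulr0 mul0r subrr.
    by rewrite -normal_ordering_adX Tp mulr0 mul0r subrr.
  apply: (@leq_trans (msize p)); last by rewrite -ltnS.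
  rewrite msizeE big_seq.
  have p0 : (0 < msize p)%N by rewrite lt0n msize_poly_eq0.
  elim/big_ind: _ => // [x y hx hy|m]; first by rewrite gtn_max hx.
  rewrite mcoeff_msupp mcoeff_mderiv => nzm;
    apply: leq_ltn_trans (msize_mdeg_lt (_ : m + U_(i) \in msupp p)%MM).
    by rewrite mdegD mdeg1 addn1.
  by rewrite mcoeff_msupp; apply: contra nzm => /eqP ->; rewrite mul0rn.
have pC : p = (p@_0)%:MP.
  apply/mpolyP => m; rewrite mcoeffC; case: eqVneq => [->|nz];
    first by rewrite mulr1.
  have [i mi] : exists i, m i != 0%N.
    by apply/existsP; apply: contraNT nz; rewrite negb_exists => /forallP m0;
      apply/eqP/mnmP => i; rewrite mnm0E; apply/eqP; rewrite -[_ == _]negbK m0.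
  have le : (U_(i) <= m)%MM.
    by apply/mnm_lepP => j; rewrite mnm1E; case: eqP => // <-; rewrite lt0n.
  have := mcoeff_mderiv i p (m - U_(i))%MM;
    rewrite dp mcoeff0 submK // => /esym/eqP.
  by rewrite mulrn_eq0 mulr0 => /eqP.
move: Tp; rewrite pC -[_%:MP]mulr1 mul_mpolyC linearZ /= normal_ordering1.
by move=> /eqP; rewrite scaler_eq0 oner_eq0 orbF => /eqP ->; rewrite scale0r.
Qed.

End NormalOrdering.

Section Presentation.
Variables (K : numFieldType) (n : nat) (A : algType K) (x d : 'I_n -> A).
Hypothesis xC : forall i j, x i * x j = x j * x i.
Hypothesis dC : forall i j, d i * d j = d j * d i.
Hypothesis dx : forall i j, d i * x j - x j * d i = (i == j)%:R.
Hypothesis A_ind : forall Q : A -> Prop,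
    Q 1 -> (forall a u v, Q u -> Q v -> Q (a *: u + v)) ->
    (forall u v, Q u -> Q v -> Q (u * v)) ->
    (forall i, Q (x i)) -> (forall i, Q (d i)) ->
  forall u, Q u.
Local Notation T := (normal_ordering x d).

(** Normally ordered elements include 1 and are stable under left multiplication by the generators,
    hence by all of A. *)
Lemma normal_form u : exists p, u = T p.
Proof.
suff /(_ 1) [q] : forall p, exists q, u * T p = T q.
  by rewrite normal_ordering1 mulr1; exists q.
elim/A_ind: u => [|a u v hu hv|u v hu hv|i|i] p.
- by exists p; rewrite mul1r.
- have [[q hq] [q' hq']] := (hu p, hv p); exists (a *: q + q').
  by rewrite linearP /= -hq -hq' mulrDl scalerAl.
- by have [q hq] := hv p; have [q' hq'] := hu q; exists q'; rewrite -mulrA hq.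
- exists ('X_(lshift n i) * p); exact: (normal_ordering_mulX _ xC).
- exists (p * 'X_(rshift n i) + p^`M(lshift n i)).
  exact: (normal_ordering_mulPl dC dx).
Qed.

(** The map is defined on normal forms, which are unique in A. Left multiplication by a generator
    obeys the same formulas in A and in B, so multiplicativity follows by induction on the left
    factor; injectivity comes from uniqueness of normal forms in B. *)
Lemma presentation_universal (B : algType K) (X P : 'I_n -> B) :
    (forall i j, X i * X j = X j * X i) -> (forall i j, P i * P j = P j * P i)
      ->
    (forall i j, P i * X j - X j * P i = (i == j)%:R) ->
  exists Phi : {lrmorphism A -> B}, [/\ injective Phi,
    forall i, Phi (x i) = X i & forall i, Phi (d i) = P i].
Proof.
move=> XC PC PX; have [N NE] := choice normal_form.
pose f u := normal_ordering X P (N u).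
have NT p : N (T p) = p by apply: (normal_ordering_inj xC dC dx); rewrite -NE.
have fT p : f (T p) = normal_ordering X P p by rewrite /f NT.
have lf : linear f.
  move=> a u v; rewrite (NE u) (NE v).
  by rewrite -[_ + _](normal_ordering_is_linear x d) !fT linearP.
have fX i u : f (x i * u) = X i * f u.
  by rewrite (NE u) (normal_ordering_mulX _ xC) !fT -(normal_ordering_mulX _
    XC).
have fP i u : f (d i * u) = P i * f u.
  by rewrite (NE u) (normal_ordering_mulPl dC dx) !fT -(normal_ordering_mulPl
    PC PX).
have f1 : f 1 = 1 by rewrite -(normal_ordering1 x d) fT normal_ordering1.
have fM u v : f (u * v) = f u * f v.
  elim/A_ind: u v => [|a u u' hu hu'|u u' hu hu'|i|i] v.
  - by rewrite mul1r f1 mul1r.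
  - by rewrite mulrDl -scalerAl !lf hu hu' mulrDl scalerAl.
  - by rewrite -mulrA !hu hu' mulrA.
  - by rewrite fX -[x i]mulr1 fX f1 mulr1.
  - by rewrite fP -[d i]mulr1 fP f1 mulr1.
exists (mk_lrmorphism lf (conj f1 fM)); split.
- move=> u v; rewrite (NE u) (NE v) /= !fT.
  by move/(normal_ordering_inj XC PC PX) ->.
- by move=> i; rewrite /= -[x i]mulr1 fX f1 mulr1.
- by move=> i; rewrite /= -[d i]mulr1 fP f1 mulr1.
Qed.

End Presentation.

Section WeylGenerators.
Variables (K : numFieldType) (n : nat).
Local Notation A := (weyl K n).

Definition weylX (i : 'I_n) : A := Weyl (mulX_weyl K i).
Definition weylP (i : 'I_n) : A := Weyl (derX_weyl K i).

Lemma weyl_opP (d d' : A) : (forall p, weyl_op d p = weyl_op d' p) -> d = d'.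
Proof. by move=> e; apply/val_inj/linendP. Qed.

Lemma weylPC i j : weylP i * weylP j = weylP j * weylP i.
Proof. by apply: weyl_opP => p; apply: mderiv_comm. Qed.
Lemma weyl_ind (Q : A -> Prop) :
    Q 1 -> (forall a u v, Q u -> Q v -> Q (a *: u + v)) ->
    (forall u v, Q u -> Q v -> Q (u * v)) ->
    (forall i, Q (weylX i)) -> (forall i, Q (weylP i)) ->
  forall d, Q d.
Proof.
move=> Q1 QL QM QX QP [d dW]; have /asboolP dP := dW.
pose S : {pred linend {mpoly K[n]}} :=
  fun u => `[< exists2 w : A, weyl_op w = u & Q w >].
have /asboolP [w wd Qw] : d \in S.
  apply: dP => [|i|i].
  - split=> [|a u v|u v].
    + by apply/asboolP; exists 1.
    + move=> /asboolP [w <- Qw] /asboolP [w' <- Qw'].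
      by apply/asboolP; exists (a *: w + w') => //; apply: QL.
    + move=> /asboolP [w <- Qw] /asboolP [w' <- Qw'].
      by apply/asboolP; exists (w * w') => //; apply: QM.
  - by apply/asboolP; exists (weylX i).
  - by apply/asboolP; exists (weylP i).
by have <- : w = Weyl dW by apply: val_inj.
Qed.

End WeylGenerators.

(** * Division rings of fractions *)

Section DivisionRing.
Variable D : unitRingType.
Hypothesis D_div : forall x : D, x != 0 -> x \is a GRing.unit.
Implicit Types x y : D.

Lemma div_neq0M x y : x != 0 -> y != 0 -> x * y != 0.
Proof.
by move=> nx ny; apply: contra ny => /eqP xy;
  rewrite -[y](mulKr (D_div nx)) xy mulr0.
Qed.

Lemma div_frac_cancel x y u : y != 0 -> u != 0 -> (x * u) / (y * u) = x / y.
Proof. by move=> ny nu; rewrite invrM ?D_div // mulrA mulrK ?D_div. Qed.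

(** Gaussian elimination on the last coordinate, with all scalars kept on the right because D need
    not be commutative. *)
Lemma division_dependence N (c : 'I_N.+1 -> 'I_N -> D) :
  exists l : 'I_N.+1 -> D, (exists k, l k != 0) /\
    forall i, \sum_k c k i * l k = 0.
Proof.
elim: N c => [|N IHN] c.
  by exists (fun=> 1); split=> [|[]//]; exists ord0; rewrite oner_neq0.
have [/forallP c0|] := boolP [forall k, c k ord_max == 0].
  have [l [[k lk] hl]] := IHN (fun k i => c (lift ord_max k) (lift ord_max i)).
  exists (fun k => if unlift ord_max k is Some j then l j else 0); split.
    by exists (lift ord_max k); rewrite liftK.
  move=> i; rewrite (bigD1_ord ord_max) //= unlift_none mulr0 add0r.
  case: (unliftP ord_max i) => [i' ->|->].
    by rewrite -[RHS](hl i'); apply: eq_bigr => j _; rewrite liftK.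
  by rewrite big1 // => j _; rewrite (eqP (c0 _)) mul0r.
rewrite negb_forall => /existsP [k0 nz];
  pose t k := (c k0 ord_max)^-1 * c k ord_max.
have [l [[k lk] hl]] := IHN (fun k i =>
  c (lift k0 k) (lift ord_max i) - c k0 (lift ord_max i) * t (lift k0 k)).
exists (fun k => if unlift k0 k is Some j then l j
                 else - \sum_j t (lift k0 j) * l j); split.
  by exists (lift k0 k); rewrite liftK.
move=> i; rewrite (bigD1_ord k0) //= unlift_none mulrN mulr_sumr addrC -sumrB.
case: (unliftP ord_max i) => [i' ->|->].
  by rewrite -[RHS](hl i'); apply: eq_bigr => j _; rewrite liftK mulrBl mulrA.
by rewrite big1 // => j _; rewrite liftK /t !mulrA mulrV ?D_div // mul1r subrr.
Qed.

End DivisionRing.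

(** * Extending embeddings to the skew field of fractions *)

Section OreExtension.
Variables (K : comNzRingType) (A : algType K) (F L : unitAlgType K).
Variable iota : {lrmorphism A -> F}.
Hypothesis hF : skew_field_of_fractions iota.
Hypothesis L_div : forall x : L, x != 0 -> x \is a GRing.unit.
Variable Phi : {lrmorphism A -> L}.
Hypothesis Phi_inj : injective Phi.

Let F_div (x : F) : x != 0 -> x \is a GRing.unit. Proof. by case: hF => h _ _;
  apply: h. Qed.
Let iota_inj : injective iota. Proof. by case: hF. Qed.
Let iota_neq0 (a : A) : a != 0 -> iota a != 0. Proof. by rewrite raddf_eq0. Qed.
Let Phi_neq0 (a : A) : a != 0 -> Phi a != 0. Proof. by rewrite raddf_eq0. Qed.
Let A_neq0M (a b : A) : a != 0 -> b != 0 -> a * b != 0.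
Proof.
move=> na nb; have := div_neq0M F_div (iota_neq0 na) (iota_neq0 nb).
by rewrite -rmorphM raddf_eq0.
Qed.

(** The right Ore condition: write b^-1 a in F as a right fraction u v^-1 and clear denominators. *)
Lemma right_ore (a b : A) : b != 0 -> exists u v, v != 0 /\ a * v = b * u.
Proof.
move=> nb; have [_ _ /(_ ((iota b)^-1 * iota a)) [u [v [nv e]]]] := hF.
exists u, v; split=> //; apply: iota_inj; rewrite !rmorphM.
have := congr1 (fun x => iota b * x * iota v) e.
by rewrite /= mulrA mulVKr ?mulrA ?mulrVK ?F_div ?iota_neq0.
Qed.

(** The value on a fraction does not depend on its representation, because the Ore condition brings
    two right fractions to a common denominator. The same device gives additivity; for products it
    rewrites the inner b^-1 a' as u v^-1. *)
Lemma ore_extension : exists psi : {lrmorphism F -> L},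
  injective psi /\ forall a, psi (iota a) = Phi a.
Proof.
have /choice [nd ndE] : forall x : F, exists nd : A * A,
    nd.2 != 0 /\ x = iota nd.1 / iota nd.2.
  by move=> x; have [_ _ /(_ x) [a [b ab]]] := hF; exists (a, b).
pose psi x := Phi (nd x).1 / Phi (nd x).2.
have psiE a b : b != 0 -> psi (iota a / iota b) = Phi a / Phi b.
  move=> nb; rewrite /psi; set x := _ / iota b; have [nd0 xE] := ndE x.
  have [u [v [nv e]]] := right_ore b nd0.
  have nu : u != 0.
    by apply: contraTneq (A_neq0M nb nv) => u0; rewrite e u0 mulr0 eqxx.
  rewrite -(div_frac_cancel L_div (Phi (nd x).1) (Phi_neq0 nd0) (Phi_neq0 nu)).
  rewrite -(div_frac_cancel L_div (Phi a) (Phi_neq0 nb) (Phi_neq0 nv)).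
  rewrite -!rmorphM -e; congr (Phi _ / _); apply: iota_inj.
  have := xE; rewrite {1}/x -(div_frac_cancel F_div (iota a) (iota_neq0 nb)
    (iota_neq0 nv)).
  rewrite -(div_frac_cancel F_div (iota (nd x).1) (iota_neq0 nd0) (iota_neq0
    nu)).
  rewrite -!rmorphM -e => /(congr1 (fun y => y * iota (b * v))) /=.
  by rewrite !mulrVK ?F_div ?iota_neq0 ?A_neq0M.
have psi_iota a : psi (iota a) = Phi a.
  by have := psiE a 1 (oner_neq0 _); rewrite !rmorph1 !divr1.
have lf : linear psi.
  move=> k x y; have [nb ->] := ndE x; have [nc ->] := ndE y.
  set a := (nd x).1; set b := (nd x).2; set a' := (nd y).1; set c := (nd y).2.
  have [u [v [nv e]]] := right_ore b nc.
  have nu : u != 0.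
    by apply: contraTneq (A_neq0M nb nv) => u0; rewrite e u0 mulr0 eqxx.
  rewrite !psiE //.
  rewrite -(div_frac_cancel L_div (Phi a) (Phi_neq0 nb) (Phi_neq0 nv)).
  rewrite -(div_frac_cancel L_div (Phi a') (Phi_neq0 nc) (Phi_neq0 nu)).
  rewrite -(div_frac_cancel F_div (iota a) (iota_neq0 nb) (iota_neq0 nv)).
  rewrite -(div_frac_cancel F_div (iota a') (iota_neq0 nc) (iota_neq0 nu)).
  rewrite -!rmorphM -e !scalerAl -!mulrDl -!linearZ -!rmorphD psiE //.
  exact: A_neq0M.
have mf : monoid_morphism psi.
  split=> [|x y]; first by rewrite -(rmorph1 iota) psi_iota rmorph1.
  have [nb ->] := ndE x; have [nc ->] := ndE y.
  set a := (nd x).1; set b := (nd x).2; set a' := (nd y).1; set c := (nd y).2.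
  have [u [v [nv e]]] := right_ore a' nb.
  (* Stated for any target, so that one identity serves both [iota] in F and [Phi] in L. *)
  have mulE (M : unitAlgType K) (f : {lrmorphism A -> M})
      (M_div : forall z : M, z != 0 -> z \is a GRing.unit)
      (f_inj : injective f) :
      f a / f b * (f a' / f c) = f (a * u) / f (c * v).
    have unit z : z != 0 -> f z \is a GRing.unit.
      by move=> nz; apply: M_div; rewrite raddf_eq0.
    rewrite !rmorphM invrM ?unit // !mulrA; congr (_ / _).
    rewrite -[LHS](mulrK (unit v nv)); congr (_ / _).
    have e' : f a' * f v = f b * f u by rewrite -!rmorphM e.
    by rewrite -!mulrA e' mulKr ?unit.
  by rewrite !psiE // !mulE // psiE // A_neq0M.
exists (mk_lrmorphism lf mf); split=> //= x y.
suff psi0 z : psi z = 0 -> z = 0.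
  move=> e; apply/eqP; rewrite -subr_eq0; apply/eqP/psi0.
  by rewrite addrC -scaleN1r lf e scaleN1r addNr.
have [nb ->] := ndE z; rewrite psiE // => /(congr1 (fun w => w * Phi (nd z).2))
  /=.
rewrite mul0r mulrVK ?L_div ?Phi_neq0 // => /eqP;
  rewrite raddf_eq0 // => /eqP ->.
by rewrite rmorph0 mul0r.
Qed.

End OreExtension.

(** * Finite right spans over the image of an endomorphism *)

Section FiniteSpan.
Variables (K : comNzRingType) (A : algType K) (F : unitAlgType K).
Variable iota : {lrmorphism A -> F}.
Hypothesis hF : skew_field_of_fractions iota.
Variables (psi : {lrmorphism F -> F}) (I : finType) (m : I -> F).

Definition right_span x := exists l : I -> F, x = \sum_i m i * psi (l i).

Hypothesis span1 : right_span 1.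
Hypothesis span_mul : forall a x, right_span x -> right_span (iota a * x).

Let F_div (x : F) : x != 0 -> x \is a GRing.unit. Proof. by case: hF => h _ _;
  apply: h. Qed.

Lemma right_spanD x y : right_span x -> right_span y -> right_span (x + y).
Proof.
move=> [l ->] [l' ->]; exists (fun i => l i + l' i).
by rewrite -big_split; apply: eq_bigr => i _; rewrite rmorphD mulrDr.
Qed.

Lemma right_spanM x y : right_span x -> right_span (x * psi y).
Proof.
move=> [l ->]; exists (fun i => l i * y).
by rewrite mulr_suml; apply: eq_bigr => i _; rewrite rmorphM mulrA.
Qed.

Lemma right_span0 : right_span 0.
Proof. by exists (fun=> 0); rewrite big1 // => i _; rewrite rmorph0 mulr0. Qed.

Lemma right_span_sum (J : Type) (s : seq J) (P : pred J) (G : J -> F) :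
  (forall j, P j -> right_span (G j)) -> right_span (\sum_(j <- s | P j) G j).
Proof. by apply: big_ind => [|x y];
  [apply: right_span0 | apply: right_spanD]. Qed.

(* The powers of b in a finite right span are dependent, so that b^-1 is a
   right combination of nonnegative powers of b. *)
Lemma right_span_full x : right_span x.
Proof.
have [_ _ /(_ x) [a [b [nb ->]]]] := hF; apply: span_mul.
set be := iota b; have nbe : be != 0.
  by case: hF => _ inj _; rewrite raddf_eq0.
have ube := F_div nbe.
have span_exp k : right_span (be ^+ k).
  by elim: k => [|k IHk]; rewrite ?expr0 // exprS; apply: span_mul.
have [c cE] := choice span_exp.
(* There is one more power of be than there are spanning elements, so their coordinate vectors are
   dependent. *)
have [l [[k1 lk1] hl]] := division_dependence F_div
  (fun (k : 'I_(#|I|).+1) (i : 'I_#|I|) => c k (enum_val i)).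
have dep : \sum_(k < (#|I|).+1) be ^+ k * psi (l k) = 0.
  under eq_bigr do rewrite cE mulr_suml.
  rewrite exchange_big big1 // => i _ /=.
  under eq_bigr do rewrite -mulrA -rmorphM.
  rewrite -mulr_sumr -rmorph_sum /=.
  by have := hl (enum_rank i); rewrite enum_rankK => ->; rewrite rmorph0 mulr0.
pose P (k : nat) := [exists j : 'I_(#|I|).+1, (val j == k) && (l j != 0)].
have exP : exists k, P k by exists (val k1); apply/existsP; exists k1;
  rewrite eqxx.
case: (ex_minnP exP) => _ /existsP [k0 /andP [/eqP <- lk0]] k0_min.
have low (k : 'I_(#|I|).+1) : (k < k0)%N -> l k = 0.
  move=> lt; apply/eqP; apply: contraTT lt => nz; rewrite -leqNgt;
    apply: k0_min.
  by apply/existsP; exists k; rewrite eqxx.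
have ul := F_div lk0; have upsi : psi (l k0) \is a GRing.unit by apply:
  rmorph_unit.
(* As k0 is the least index with a nonzero coefficient, be^k0 cancels on the left of the relation.
   For k < k0 the truncated exponent does no harm, since [l k] is zero. *)
have -> : be^-1 = \sum_(k < (#|I|).+1 | k != k0)
    - (be ^+ (k - k0).-1 * psi (l k / l k0)).
  apply: (mulrI ube); rewrite mulrV // mulr_sumr.
  apply: (mulIr upsi); apply: (mulrI (unitrX k0 ube)).
  rewrite mul1r mulr_suml mulr_sumr; apply/eqP; rewrite -subr_eq0 -sumrN;
    apply/eqP.
  rewrite -[RHS]dep [RHS](bigD1 k0) //=; congr (_ + _); apply: eq_bigr => k ne.
  have [lt|gt|e] := ltngtP k k0; last by rewrite (val_inj e) eqxx in ne.
    by rewrite low // mul0r !rmorph0 !mulr0 !oppr0 mulr0 mul0r mulr0 oppr0.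
  rewrite mulrN mulNr mulrN opprK -!mulrA -rmorphM mulrVK // [be * _]mulrA
    -exprS.
  by rewrite prednK ?subn_gt0 // mulrA -exprD subnKC // ltnW.
apply: right_span_sum => k _; rewrite -mulrN -rmorphN; exact: right_spanM.
Qed.

End FiniteSpan.

(** * Dual derivations *)

Section Bracket.
Variable R : pzRingType.
Implicit Types x y z : R.

Definition bracket x y := x * y - y * x.

Lemma bracket_suml (I : Type) (s : seq I) (F : I -> R) y :
  bracket (\sum_(i <- s) F i) y = \sum_(i <- s) bracket (F i) y.
Proof. by rewrite /bracket mulr_suml mulr_sumr sumrB. Qed.
Lemma bracket_sumr (I : Type) (s : seq I) (F : I -> R) y :
  bracket y (\sum_(i <- s) F i) = \sum_(i <- s) bracket y (F i).
Proof. by rewrite /bracket mulr_suml mulr_sumr sumrB. Qed.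
Lemma bracketMr x y z : bracket x (y * z) = bracket x y * z + y * bracket x z.
Proof. by rewrite /bracket mulrBl mulrBr !mulrA addrA subrK. Qed.
Lemma bracketMl x y z : bracket (x * y) z = bracket x z * y + x * bracket y z.
Proof. by rewrite /bracket mulrBl mulrBr !mulrA [RHS]addrC addrA subrK. Qed.
Lemma bracketBl x y z : bracket (x - y) z = bracket x z - bracket y z.
Proof. by rewrite /bracket mulrBl mulrBr !opprB [LHS](AC (2*2) ((1*4)*(3*2))).
  Qed.
Lemma bracket_jacobi x y z :
  bracket (bracket x y) z = bracket x (bracket y z) - bracket y (bracket x z).
Proof.
rewrite /bracket !mulrBl !mulrBr !mulrA !(opprB, opprD).
rewrite [RHS](AC ((2*2)*(2*2)) (((1*8)*(3*6))*((2*5)*(7*4))))/=.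
by rewrite !(addNr, subrr) !addr0.
Qed.

End Bracket.

Section DualDerivations.
Variables (K : numFieldType) (n : nat) (F : unitAlgType K).
Hypothesis F_div : forall x : F, x != 0 -> x \is a GRing.unit.
Variables (mu : {lrmorphism {mpoly K[n]} -> F}) (dd : 'I_n -> F).
Hypothesis mu_inj : injective mu.
Hypothesis ddC : forall i j, dd i * dd j = dd j * dd i.
Hypothesis dd_mu : forall j p, bracket (dd j) (mu p) = mu p^`M(j).
Implicit Types (p q : {mpoly K[n]}) (u v : F).

Let mu_unit q : q != 0 -> mu q \is a GRing.unit.
Proof. by move=> nq; apply: F_div; rewrite raddf_eq0. Qed.

Let muC p q : mu p * mu q = mu q * mu p.
Proof. by rewrite -!rmorphM mulrC. Qed.

(* Membership in the subfield K(x_1, ..., x_n) of F. *)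
Definition rational u := exists p q, q != 0 /\ u * mu q = mu p.

Lemma rational_mu p : rational (mu p).
Proof. by exists p, 1; rewrite oner_neq0 rmorph1 mulr1. Qed.

Lemma rational_frac p q : q != 0 -> rational ((mu q)^-1 * mu p).
Proof. by move=> nq; exists p, q; rewrite -mulrA muC mulKr ?mu_unit. Qed.

Lemma rational_muC u p : rational u -> u * mu p = mu p * u.
Proof.
move=> [r [q [nq e]]]; apply: (mulIr (mu_unit nq)).
by rewrite -!mulrA e [mu p * mu q]muC mulrA e muC.
Qed.

Lemma rationalD u v : rational u -> rational v -> rational (u + v).
Proof.
move=> [p [q [nq e]]] [p' [q' [nq' e']]].
exists (p * q' + p' * q), (q * q'); rewrite mulf_neq0 //; split=> //.
by rewrite rmorphD !rmorphM mulrDl mulrA e [mu q * _]muC mulrA e'.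
Qed.

Lemma rationalM u v : rational u -> rational v -> rational (u * v).
Proof.
move=> [p [q [nq e]]] [p' [q' [nq' e']]].
exists (p * p'), (q' * q); rewrite mulf_neq0 //; split=> //.
by rewrite !rmorphM mulrA -(mulrA u) e' -mulrA [mu p' * _]muC mulrA e.
Qed.

Lemma rational0 : rational 0.
Proof. by rewrite -(rmorph0 mu); apply: rational_mu. Qed.

Lemma rationalC u v : rational u -> rational v -> u * v = v * u.
Proof.
move=> ru [p [q [nq e]]]; apply: (mulIr (mu_unit nq)).
by rewrite -mulrA e (rational_muC _ ru) -mulrA (rational_muC _ ru) mulrA e.
Qed.

Lemma rational_dd j u : rational u -> rational (bracket (dd j) u).
Proof.
move=> ru; have [p [q [nq e]]] := ru.
exists (p^`M(j) * q - p * q^`M(j)), (q * q); rewrite mulf_neq0 //; split=> //.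
have : bracket (dd j) u * mu q = mu p^`M(j) - u * mu q^`M(j).
  by rewrite -!dd_mu -e bracketMr addrK.
rewrite rmorphM mulrA => ->; rewrite mulrBl -mulrA [_ * mu q in X in _ - X]muC.
by rewrite mulrA e rmorphB !rmorphM.
Qed.

(** Vector fields with rational coefficients, as elements of F. *)
Definition derivation_form u :=
  exists a : 'I_n -> F, (forall j, rational (a j)) /\ u = \sum_j a j * dd j.

Lemma derivation_formD u v :
  derivation_form u -> derivation_form v -> derivation_form (u + v).
Proof.
move=> [a [ra ->]] [b [rb ->]]; exists (fun j => a j + b j).
split=> [j|]; first exact: rationalD.
by rewrite -big_split; apply: eq_bigr => j _; rewrite mulrDl.
Qed.

Lemma derivation_formM u v :
  rational u -> derivation_form v -> derivation_form (u * v).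
Proof.
move=> ru [b [rb ->]]; exists (fun j => u * b j).
split=> [j|]; first exact: rationalM.
by rewrite mulr_sumr; apply: eq_bigr => j _; rewrite mulrA.
Qed.

Lemma derivation_formB u v :
  derivation_form u -> derivation_form v -> derivation_form (u - v).
Proof.
move=> du dv; apply: derivation_formD du _; rewrite -mulN1r.
by apply: derivation_formM dv; rewrite -(rmorphN1 mu); apply: rational_mu.
Qed.

Lemma derivation_form_dd j : derivation_form (dd j).
Proof.
exists (fun k => (j == k)%:R); split=> [k|].
  by rewrite -(rmorph_nat mu); apply: rational_mu.
rewrite (bigD1 j) //= eqxx mul1r big1 ?addr0 // => k.
by rewrite eq_sym => /negPf ->; rewrite mul0r.
Qed.

Lemma derivation_form_sum (I : Type) (s : seq I) (G : I -> F) :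
  (forall i, derivation_form (G i)) -> derivation_form (\sum_(i <- s) G i).
Proof.
move=> dG; apply: big_ind => [|u v|i _]; [|exact: derivation_formD|exact: dG].
by exists (fun=> 0); split=> [j|]; [apply: rational0 | rewrite big1 // => j _;
  rewrite mul0r].
Qed.

(** Second-order terms cancel because rational functions commute with one another and so do the
    [dd j]. *)
Lemma derivation_form_bracket u v :
  derivation_form u -> derivation_form v -> derivation_form (bracket u v).
Proof.
move=> [a [ra ->]] [b [rb ->]]; rewrite bracket_suml.
apply: derivation_form_sum => j; rewrite bracket_sumr.
apply: derivation_form_sum => k.
have -> : bracket (a j * dd j) (b k * dd k) =
    a j * (bracket (dd j) (b k) * dd k) - b k * (bracket (dd k) (a j) * dd j).
  have ab0 : bracket (a j) (b k) = 0 by rewrite /bracket (rationalC (ra j))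
    ?subrr.
  have dd0 : bracket (dd j) (dd k) = 0 by rewrite /bracket ddC subrr.
  rewrite bracketMr !bracketMl ab0 dd0 mul0r add0r mulr0 addr0 -mulrA;
    congr (_ + _).
  by rewrite -mulrN -mulNr /bracket opprB.
by apply: derivation_formB; apply: derivation_formM => //;
  apply: derivation_formM (derivation_form_dd _); apply: rational_dd.
Qed.

Variable f : 'I_n -> {mpoly K[n]}.
Let J := \matrix_(i, k) (f i)^`M(k).
Let JE i k : J i k = (f i)^`M(k). Proof. exact: mxE. Qed.
Hypothesis J_neq0 : \det J != 0.

(** The coefficients of u form a null vector of the Jacobian; multiplying by the adjugate and
    cancelling the determinant makes them zero. *)
Lemma derivation_form0 u : derivation_form u ->
  (forall k, bracket u (mu (f k)) = 0) -> u = 0.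
Proof.
move=> [a [ra ->]] u0; rewrite big1 // => i _.
suff -> : a i = 0 by rewrite mul0r.
apply: (mulIr (mu_unit J_neq0)); rewrite mul0r.
have uJ k : \sum_j a j * mu (J k j) = 0.
  rewrite -[RHS](u0 k) bracket_suml; apply: eq_bigr => j _.
  by rewrite bracketMl dd_mu /bracket (rational_muC (f k) (ra j)) subrr mul0r
    add0r mxE.
transitivity (\sum_k (\sum_j a j * mu (J k j)) * mu ((\adj J) i k)); last first.
  by rewrite big1 // => k _; rewrite uJ mul0r.
under eq_bigr do rewrite mulr_suml.
rewrite exchange_big /=; transitivity (\sum_j a j * mu ((\adj J *m J) i j)).
  rewrite mul_adj_mx (bigD1 i) //= mxE eqxx mulr1n big1 ?addr0 // => j.
  by rewrite eq_sym mxE => /negPf ->; rewrite mulr0n rmorph0 mulr0.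
apply: eq_bigr => j _; rewrite mxE rmorph_sum mulr_sumr;
  apply: eq_bigr => k _ /=.
by rewrite rmorphM -mulrA [mu (J k j) * _]muC.
Qed.

(** Cramer's rule: the coefficients are column i of the inverse Jacobian, so this is the derivation
    with respect to f_i. *)
Definition dual i := (mu (\det J))^-1 * \sum_j mu ((\adj J) j i) * dd j.

Lemma derivation_form_dual i : derivation_form (dual i).
Proof.
exists (fun j => (mu (\det J))^-1 * mu ((\adj J) j i)); split=> [j|].
  exact: rational_frac.
by rewrite /dual mulr_sumr; apply: eq_bigr => j _; rewrite mulrA.
Qed.

Lemma bracket_dual i k : bracket (dual i) (mu (f k)) = (i == k)%:R.
Proof.
rewrite /dual bracketMl bracket_suml.
have -> : bracket (mu (\det J))^-1 (mu (f k)) = 0.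
  have r : rational (mu (\det J))^-1.
    by rewrite -[_^-1]mulr1 -(rmorph1 mu); apply: rational_frac.
  by rewrite /bracket rational_muC // subrr.
rewrite mul0r add0r; apply: (mulrI (mu_unit J_neq0));
  rewrite mulVKr ?mu_unit //.
transitivity (mu ((J *m \adj J) k i)).
  rewrite mxE rmorph_sum; apply: eq_bigr => j _.
  have mu0 : bracket (mu ((\adj J) j i)) (mu (f k)) = 0 by rewrite /bracket muC
    subrr.
  by rewrite bracketMl dd_mu mu0 mul0r add0r rmorphM muC /= JE.
by rewrite mul_mx_adj mxE eq_sym; case: eqP => _;
  rewrite ?mulr1 // rmorph0 mulr0.
Qed.

(** By the Jacobi identity the commutator kills every f_k, as the brackets with f_k are the central
    constants 0 and 1. *)
Lemma dualC i j : dual i * dual j = dual j * dual i.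
Proof.
apply/eqP; rewrite -subr_eq0; apply/eqP/derivation_form0 => [|k].
  by apply: derivation_form_bracket; apply: derivation_form_dual.
by rewrite bracket_jacobi !bracket_dual /bracket !commr_nat !subrr.
Qed.

Lemma dd_dual k : dd k = \sum_i mu (f i)^`M(k) * dual i.
Proof.
apply: (mulrI (mu_unit J_neq0)); rewrite mulr_sumr.
transitivity (\sum_j mu ((\adj J *m J) j k) * dd j).
  rewrite mul_adj_mx (bigD1 k) //= mxE eqxx mulr1n big1 ?addr0 // => j /negPf
    nj.
  by rewrite mxE nj mulr0n rmorph0 mul0r.
under eq_bigr do rewrite mxE rmorph_sum mulr_suml.
rewrite exchange_big; apply: eq_bigr => i _ /=.
rewrite /dual mulrA muC -mulrA mulVKr ?mu_unit // mulr_sumr.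
by apply: eq_bigr => j _; rewrite rmorphM [_ * mu (J _ _)]muC JE mulrA.
Qed.

(** G preserves rational functions and sends the [dd j] to combinations of the [dd k], so G(D_i) -
    D_i is a vector field; it kills every f_k because G fixes f_k. *)
Lemma dual_fixed (G : {lrmorphism F -> F}) (op : {mpoly K[n]} -> {mpoly K[n]})
    (c : 'I_n -> 'I_n -> K) :
    (forall p, G (mu p) = mu (op p)) ->
    (forall j, G (dd j) = \sum_k c j k *: dd k) ->
    (forall k, op (f k) = f k) ->
  forall i, G (dual i) = dual i.
Proof.
move=> Gmu Gdd opf i.
have Grational u : rational u -> rational (G u).
  move=> [p [q [nq e]]]; exists (op p), (op q); split.
    (* The new denominator is nonzero because G sends the unit [mu q] to a unit. *)
    apply: contraTneq (mu_unit nq) => op0; have := rmorph_unit G (mu_unit nq).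
    by rewrite /= Gmu op0 rmorph0 unitr0.
  by rewrite -!Gmu -e rmorphM.
apply/eqP; rewrite -subr_eq0; apply/eqP/derivation_form0 => [|k].
  apply: derivation_formB (derivation_form_dual i).
  have [a [ra ->]] := derivation_form_dual i; rewrite rmorph_sum.
  apply: derivation_form_sum => j; rewrite rmorphM; apply: derivation_formM;
    first exact: Grational.
  rewrite /= Gdd; apply: derivation_form_sum => k.
  rewrite -mulr_algl -(rmorph_alg mu);
    apply: derivation_formM (derivation_form_dd k).
  exact: rational_mu.
rewrite bracketBl bracket_dual -{1}(opf k) -Gmu.
have -> : bracket (G (dual i)) (G (mu (f k))) = G (bracket (dual i) (mu (f k))).
  by rewrite rmorphB !rmorphM.
by rewrite bracket_dual rmorph_nat subrr.
Qed.

End DualDerivations.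

(** * The fixed division ring *)

Section MonomialSpan.
Variables (K : numFieldType) (n : nat) (T : groupType) (W : {fset T}).
Variable op : T -> {lrmorphism {mpoly K[n]} -> {mpoly K[n]}}.
Hypothesis W_group : group_closed [pred g in W].
Hypothesis op1 : forall p, op 1%g p = p.
Hypothesis opM : forall g h p, op g (op h p) = op (g * h)%g p.
Implicit Types (p q : {mpoly K[n]}).

(** Exponents below the order of W suffice, as each x_i satisfies a monic equation of that degree
    over the invariants. *)
Definition exponents := {ffun 'I_n -> 'I_(#|` W|)}.
Definition emonom (a : exponents) : {mpoly K[n]} := \prod_i 'X_i ^+ a i.

Let spanned p := exists q : exponents -> {mpoly K[n]},
  (forall a, fixed_poly W op (q a)) /\ p = \sum_a emonom a * q a.

Let spanned_sum (I : Type) (s : seq I) (P : pred I) (G : I -> {mpoly K[n]}) :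
  (forall i, P i -> spanned (G i)) -> spanned (\sum_(i <- s | P i) G i).
Proof.
apply: big_ind => [|p p' [q [iq ->]] [q' [iq' ->]]].
  exists (fun=> 0); split=> [a|]; first exact: fixed_poly0.
  by rewrite big1 // => a _; rewrite mulr0.
exists (fun a => q a + q' a); split=> [a|]; first exact: fixed_polyD.
by rewrite -big_split; apply: eq_bigr => a _; rewrite mulrDr.
Qed.

Let spannedM p r : spanned p -> fixed_poly W op r -> spanned (p * r).
Proof.
move=> [q [iq ->]] ir; exists (fun a => q a * r); split=> [a|];
  first exact: fixed_polyM.
by rewrite mulr_suml; apply: eq_bigr => a _; rewrite mulrA.
Qed.

Let spanned_emonom a : spanned (emonom a).
Proof.
exists (fun b => (b == a)%:R); split=> [b g _|]; first by rewrite rmorph_nat.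
by rewrite (bigD1 a) //= eqxx mulr1 big1 ?addr0 // => b /negPf ->;
  rewrite mulr0.
Qed.

Let spanned_emonom_var i a : spanned ('X_i * emonom a).
Proof.
pose c := \prod_(j | j != i) 'X_j ^+ a j : {mpoly K[n]}.
have cE (k : 'I_(#|` W|)) : spanned (c * 'X_i ^+ k).
  suff -> : c * 'X_i ^+ k = emonom [ffun j => if j == i then k else a j].
    exact: spanned_emonom.
  rewrite /emonom (bigD1 i) //= ffunE eqxx mulrC; congr (_ * _).
  by apply: eq_bigr => j /negPf ni; rewrite ffunE ni.
have -> : 'X_i * emonom a = c * 'X_i ^+ (a i).+1.
  by rewrite /emonom (bigD1 i) //= mulrA -exprS mulrC.
(* If the raised exponent reaches the order of W, the orbit polynomial rewrites that power of x_i
   through lower ones. *)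
have := ltn_ord (a i); rewrite leq_eqVlt => /orP [/eqP aN|lt];
  last exact: cE (Ordinal lt).
have := orbit_poly_root W_group op1 i;
  rewrite horner_coef size_orbit_poly big_ord_recr /=.
have -> : (orbit_poly W op i)`_(#|` W|) = 1.
  have /monicP := orbit_poly_monic W op i.
  by rewrite lead_coefE size_orbit_poly.
rewrite mul1r aN addrC => /eqP; rewrite addr_eq0 => /eqP ->.
rewrite mulrN mulr_sumr -sumrN; apply: spanned_sum => k _.
set co := _`_k; have -> : - (c * (co * 'X_i ^+ k)) = (c * 'X_i ^+ k) * (-1 *:
  co).
  by rewrite scaleN1r mulrN mulrA mulrAC.
by apply: spannedM (cE k) _; apply/fixed_polyZ/orbit_poly_coef_invariant.
Qed.

Lemma emonom_span p : exists q : exponents -> {mpoly K[n]},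
  (forall a, fixed_poly W op (q a)) /\ p = \sum_a emonom a * q a.
Proof.
rewrite -/(spanned p).
have spanned_var i r : spanned r -> spanned ('X_i * r).
  move=> [q [iq ->]]; rewrite mulr_sumr; apply: spanned_sum => a _.
  by rewrite mulrA; apply: spannedM (iq a); apply: spanned_emonom_var.
have spanned1 : spanned 1.
  have W0 : (0 < #|` W|)%N by rewrite lt0n -(pnatr_eq0 K) card_W_neq0.
  suff <- : emonom [ffun=> Ordinal W0] = 1 by apply: spanned_emonom.
  by rewrite /emonom big1 // => i _; rewrite ffunE.
elim/mpolyind: p => [|b m p _ _ [q' [iq' ->]]].
  by exists (fun=> 0); split=> [a|];
    [apply: fixed_poly0 | rewrite big1 // => a _; rewrite mulr0].
suff [q [iq ->]] : spanned 'X_[m].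
  exists (fun a => b *: q a + q' a); split=> [a|];
    first exact/fixed_polyD/iq'/fixed_polyZ.
  rewrite scaler_sumr -big_split; apply: eq_bigr => a _.
  by rewrite mulrDr scalerAr.
rewrite mpolyXE_id; elim: (index_enum _) => [|i s IHs];
  first by rewrite big_nil.
rewrite big_cons; elim: (m i) => [|k IHk]; first by rewrite expr0 mul1r.
by rewrite exprS -mulrA; apply: spanned_var.
Qed.

End MonomialSpan.

Arguments emonom {K n T W} a.

Lemma mpoly_lrmorph_eq (K : comNzRingType) n (B : algType K)
    (g h : {lrmorphism {mpoly K[n]} -> B}) :
  (forall i, g 'X_i = h 'X_i) -> g =1 h.
Proof.
move=> e p; elim/mpolyind: p => [|a m p _ _ IH]; first by rewrite !rmorph0.
rewrite !rmorphD /= IH !linearZ mpolyXE_id /= !rmorph_prod; congr (_ *: _ + _).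
by apply: eq_bigr => i _; rewrite !rmorphXn /= e.
Qed.

Section FixedField.
Variables (K : numFieldType) (n : nat) (A : algType K).
Variables (mulA : {lrmorphism {mpoly K[n]} -> A}) (d : 'I_n -> A).
Hypothesis mulA_inj : injective mulA.
Hypothesis dC : forall i j, d i * d j = d j * d i.
Hypothesis d_mulA : forall j p, bracket (d j) (mulA p) = mulA p^`M(j).
Hypothesis A_ind : forall Q : A -> Prop,
    Q 1 -> (forall a u v, Q u -> Q v -> Q (a *: u + v)) ->
    (forall u v, Q u -> Q v -> Q (u * v)) ->
    (forall i, Q (mulA 'X_i)) -> (forall i, Q (d i)) ->
  forall u, Q u.
Variables (F : unitAlgType K) (iota : {lrmorphism A -> F}).
Hypothesis hF : skew_field_of_fractions iota.
Variables (T : groupType) (W : {fset T}).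
Variable op : T -> {lrmorphism {mpoly K[n]} -> {mpoly K[n]}}.
Hypothesis W_group : group_closed [pred g in W].
Hypothesis op1 : forall p, op 1%g p = p.
Hypothesis opM : forall g h p, op g (op h p) = op (g * h)%g p.
Variable act : T -> {lrmorphism F -> F}.
Hypothesis act_mu : forall g p, g \in W ->
  act g (iota (mulA p)) = iota (mulA (op g p)).
Variable c : T -> 'I_n -> 'I_n -> K.
Hypothesis act_d : forall g j, g \in W ->
  act g (iota (d j)) = \sum_k c g j k *: iota (d k).
Variable f : 'I_n -> {mpoly K[n]}.
Hypothesis f_inv : forall i, fixed_poly W op (f i).
Hypothesis f_gen : forall q, fixed_poly W op q -> generated f q.
Hypothesis J_neq0 : \det (\matrix_(i, k) (f i)^`M(k)) != 0.

Let F_div (x : F) : x != 0 -> x \is a GRing.unit. Proof. by case: hF => h _ _;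
  apply: h. Qed.
Let iota_inj : injective iota. Proof. by case: hF. Qed.

Variable mu : {lrmorphism {mpoly K[n]} -> F}.
Hypothesis muE : forall p, mu p = iota (mulA p).
Let dd i := iota (d i).
Let mu_inj : injective mu. Proof. by move=> p q;
  rewrite !muE => /iota_inj /mulA_inj. Qed.
Let ddC i j : dd i * dd j = dd j * dd i.
Proof. by rewrite /dd -!rmorphM dC. Qed.
Let dd_mu j p : bracket (dd j) (mu p) = mu p^`M(j).
Proof. by rewrite !muE -d_mulA /bracket rmorphB !rmorphM. Qed.

Local Notation dual := (dual mu dd f).

Lemma dual_morphism : exists psi : {lrmorphism F -> F}, [/\ injective psi,
  forall Q, psi (mu Q) = mu (Q \mPo [tuple f i | i < n]) &
  forall i, psi (dd i) = dual i].
Proof.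
have mulAC p q : mulA p * mulA q = mulA q * mulA p by rewrite -!rmorphM mulrC.
have muC p q : mu p * mu q = mu q * mu p by rewrite -!rmorphM mulrC.
have dX i j : d i * mulA 'X_j - mulA 'X_j * d i = (i == j)%:R.
  rewrite -[LHS]/(bracket _ _) d_mulA mderivX mnm1E eq_sym.
  case: eqP => [->|_]; last by rewrite scale0r rmorph0.
  by rewrite scale1r -[X in (X - _)%MM]add0m addmK mpolyX0 rmorph1.
have [Phi [Phi_inj PhiX Phid]] := presentation_universal
  (fun i j => mulAC 'X_i 'X_j) dC dX A_ind
  (fun i j => muC (f i) (f j)) (dualC F_div mu_inj ddC dd_mu J_neq0)
  (bracket_dual F_div mu_inj dd_mu J_neq0).
have [psi [psi_inj psiE]] := ore_extension hF F_div Phi_inj.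
exists psi; split=> // [Q|i]; last by rewrite psiE Phid.
rewrite muE psiE; pose tf := [tuple f i | i < n].
pose g : {lrmorphism {mpoly K[n]} -> F} := (Phi \o mulA)%FUN.
pose h : {lrmorphism {mpoly K[n]} -> F} := (mu \o comp_mpoly tf)%FUN.
apply: (mpoly_lrmorph_eq (g := g) (h := h)) => i.
by rewrite /= PhiX comp_mpolyXU -tnth_nth tnth_mktuple.
Qed.

Lemma fixed_image : exists psi : {lrmorphism F -> F}, injective psi /\
  forall u, (forall g, g \in W -> act g u = u) <-> exists x, u = psi x.
Proof.
have [psi [psi_inj psi_mu psi_dd]] := dual_morphism.
have gen_psi q : fixed_poly W op q -> exists x, mu q = psi x.
  by move=> /f_gen [Q ->]; exists (mu Q); rewrite psi_mu.
have psi_fix x g : g \in W -> act g (psi x) = psi x.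
  move=> gW.
  have fix_iota a : act g (psi (iota a)) = psi (iota a).
    elim/A_ind: a => [|b u1 v hu hv|u1 v hu hv|i|i].
    - by rewrite !rmorph1.
    - by rewrite !linearP /= hu hv.
    - by rewrite !rmorphM /= hu hv.
    - rewrite -muE psi_mu comp_mpolyXU -tnth_nth tnth_mktuple.
      by rewrite muE act_mu // f_inv.
    - rewrite psi_dd; apply: (dual_fixed F_div mu_inj dd_mu J_neq0 (c := c g))
      => [p|j|k].
      + by rewrite muE act_mu.
      + exact: act_d.
      + exact: f_inv.
  have [_ _ /(_ x) [a [b [nb ->]]]] := hF.
  have ub : iota b \is a GRing.unit by apply: F_div; rewrite raddf_eq0.
  rewrite rmorphM rmorphV // rmorphM rmorphV ?rmorph_unit //.
  by rewrite /= !fix_iota.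
exists psi; split=> // u; split=> [u_fix|[x ->] g]; last exact: psi_fix.
pose m a := mu (@emonom K n T W a).
have span_mu p x : right_span psi m (mu p * psi x).
  have [q [iq ->]] := emonom_span W_group op1 opM p.
  have [l lE] := choice (fun a => gen_psi _ (iq a)).
  exists (fun a => l a * x); rewrite rmorph_sum mulr_suml.
  apply: eq_bigr => a _ /=.
  have -> : mu (emonom a * q a) = m a * psi (l a).
    by rewrite -lE /m -rmorphM.
  by rewrite -mulrA -rmorphM.
have span1 : right_span psi m 1 by have := span_mu 1 1; rewrite !rmorph1 mulr1.
(* It suffices to multiply by generators. A derivation d_i is moved past the monomial and then
   expanded in the dual derivations, which lie in the image of [psi]; the coefficients of this
   expansion are polynomials. *)
have span_mul a x : right_span psi m x -> right_span psi m (iota a * x).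
  elim/A_ind: a x => [|b u1 v hu hv|u1 v hu hv|i|i] x hx.
  - by rewrite rmorph1 mul1r.
  - rewrite linearP mulrDl -scalerAl; apply: right_spanD (hv x hx).
    rewrite -[iota u1 * x]mulr1 scalerAr -(rmorph_alg psi).
    exact/right_spanM/hu.
  - by rewrite rmorphM -mulrA; apply/hu/hv.
  - have [l ->] := hx; rewrite mulr_sumr; apply: right_span_sum => a _.
    by rewrite mulrA -muE -rmorphM; apply: span_mu.
  - have [l ->] := hx; rewrite mulr_sumr; apply: right_span_sum => a _.
    rewrite mulrA; have -> : iota (d i) * m a = mu (emonom a)^`M(i) + m a * dd
      i.
      by rewrite -dd_mu /bracket subrK.
    rewrite mulrDl; apply: right_spanD; first exact: span_mu.
    rewrite (dd_dual F_div dd mu_inj J_neq0) mulr_sumr mulr_suml.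
    apply: right_span_sum => k _.
    by rewrite mulrA -rmorphM -mulrA -psi_dd -rmorphM; apply: span_mu.
have [l uE] := right_span_full hF span1 span_mul u.
(* Averages of the spanning monomials are invariant, hence in the image of [psi]. Averaging the
   expansion of u replaces each [m a] by such an average, since its right coefficients are fixed by
   W. *)
have [b bE] := choice (fun a => gen_psi _ (@avg_invariant _ _ _ _ op W_group
  opM (@emonom K n T W a))).
exists (\sum_a b a * l a); rewrite rmorph_sum.
transitivity ((#|` W|%:R)^-1 *: \sum_(g <- W) act g u).
  rewrite big_seq (eq_bigr (fun=> u)) // -big_seq big_const_seq count_predT.
  by rewrite iter_addr_0 -scaler_nat scalerA mulVf ?scale1r ?(card_W_neq0 _
    W_group).
rewrite [in LHS]big_seq (eq_bigr (fun g => \sum_a mu (op g (emonom a)) * psi (l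
  a))) => [|g gW].
  rewrite -big_seq exchange_big scaler_sumr; apply: eq_bigr => a _ /=.
  by rewrite [in RHS]rmorphM /= -bE /avg linearZ rmorph_sum -scalerAl mulr_suml.
rewrite uE rmorph_sum; apply: eq_bigr => a _; rewrite rmorphM /= psi_fix //.
by rewrite /m !muE act_mu.
Qed.

End FixedField.

(** * Polynomials inside the Weyl algebra, and the action of GL(V) *)

Section WeylMultiplication.
Variables (K : numFieldType) (n : nat).
Implicit Types p q : {mpoly K[n]}.

Fact mul_op_subproof p : linear ( *%R p).
Proof. by move=> a q r; rewrite mulrDr scalerAr. Qed.
Definition mul_op p : linend {mpoly K[n]} := Linend (mul_op_subproof p).

Lemma mul_op_weyl p : mul_op p \in @weyl_pred K n.
Proof.
have [w1 wlin wM] := weyl_closed K n.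
have opM q r : mul_op (q * r) = mul_op q * mul_op r.
  by apply: linendP => s; rewrite linendME /= mulrA.
elim/mpolyind: p => [|a m p _ _ IH].
  suff -> : mul_op 0 = (-1) *: (1 : linend _) + 1 by apply: wlin.
  by apply: linendP => s; rewrite scaleN1r addNr /= mul0r.
have -> : mul_op (a *: 'X_[m] + p) = a *: mul_op 'X_[m] + mul_op p.
  by apply: linendP => s; rewrite linendDE linendZE /= mulrDl scalerAl.
apply: (wlin) IH; rewrite mpolyXE_id.
elim: (index_enum _) => [|i s IHs].
  rewrite big_nil; suff -> : mul_op 1 = 1 by [].
  by apply: linendP => q; rewrite /= mul1r.
rewrite big_cons; elim: (m i) => [|k IHk]; first by rewrite expr0 mul1r.
rewrite exprS -mulrA opM; apply: wM IHk.
have -> : mul_op 'X_i = mulX K i by apply: linendP.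
exact: mulX_weyl.
Qed.

Definition weyl_mul p : weyl K n := Weyl (mul_op_weyl p).

Lemma weyl_mul_linear : linear weyl_mul.
Proof. by move=> a p q; apply: weyl_opP => r; rewrite /= mulrDl scalerAl. Qed.
Lemma weyl_mul_monoid_morphism : monoid_morphism weyl_mul.
Proof.
by split=> [|p q]; apply: weyl_opP => r; rewrite /= ?mul1r // -mulrA.
Qed.

Definition weyl_mulM : {lrmorphism {mpoly K[n]} -> weyl K n} :=
  mk_lrmorphism weyl_mul_linear weyl_mul_monoid_morphism.

Lemma weyl_mul_inj : injective weyl_mulM.
Proof.
move=> p q /(congr1 (fun d : weyl K n => weyl_op d 1)).
by rewrite /= !mulr1.
Qed.

Lemma weyl_mulX i : weyl_mulM 'X_i = weylX K i.
Proof. by apply: weyl_opP. Qed.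

Lemma bracket_weylP j p : bracket (weylP K j) (weyl_mulM p) = weyl_mulM p^`M(j).
Proof.
apply: weyl_opP => q; transitivity ((p * q)^`M(j) - p * q^`M(j)); first by [].
by rewrite mderivM addrK.
Qed.

End WeylMultiplication.

Arguments weyl_mulM {K n}.

Section WeylAction.
Variables (K : numFieldType) (V : vectType K) (n : nat) (e : n.-tuple V).
Hypothesis he : basis_of {:V} e.

Lemma weylact_mul g p : weylact he g (weyl_mulM p) = weyl_mulM (GLop e g p).
Proof.
apply: weyl_opP => q; transitivity (GLact e g (p * GLact e (g^-1)%g q));
  first by [].
by rewrite rmorphM /= (GLact_comp he) mulgV (GLact1 he).
Qed.

Lemma weylact_der g j :
  weylact he g (weylP K j) = \sum_k coord e k (g e`_j) *: weylP K k.
Proof.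
apply: weyl_opP => q.
transitivity (\sum_k coord e k (g e`_j) *: q^`M(k)); last first.
  elim: (index_enum _) => [|k s IHs]; first by rewrite !big_nil.
  by rewrite !big_cons IHs.
transitivity (GLact e g (GLact e (g^-1)%g q)^`M(j)); first by [].
rewrite GLact_deriv invgK linear_sum; apply: eq_bigr => k _.
by rewrite linearZ /= (GLact_comp he) mulgV (GLact1 he).
Qed.

End WeylAction.

(** The isomorphism is the inverse of an injective endomorphism [psi] of F whose image is the set of
    fixed elements; injectivity makes the chosen preimages respect the algebra structure. *)
Lemma invariants_isomorphism (K : numFieldType) (n : nat) (V : vectType K)
    (e : n.-tuple V) (he : basis_of {:V} e)
    (W : {fset GL V}) (hW : complex_reflection_group W)
    (F : unitAlgType K) (iota : {lrmorphism weyl K n -> F})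
    (hF : skew_field_of_fractions iota)
    (act : GL V -> {lrmorphism F -> F})
    (hact : forall g, g \in W -> forall d : weyl K n,
      act g (iota d) = iota (weylact he g d)) :
  exists phi : {lrmorphism invariants W act -> F}, bijective phi.
Proof.
have [f [f_inv f_gen J_neq0]] := complex_reflection_invariants he hW.
pose mu : {lrmorphism {mpoly K[n]} -> F} := (iota \o weyl_mulM)%FUN.
have A_ind : forall Q : weyl K n -> Prop,
    Q 1 -> (forall a u v, Q u -> Q v -> Q (a *: u + v)) ->
    (forall u v, Q u -> Q v -> Q (u * v)) ->
    (forall i, Q (weyl_mulM 'X_i)) -> (forall i, Q (weylP K i)) ->
    forall u, Q u.
  by move=> Q Q1 QL QM QX; apply: weyl_ind => // i; rewrite -weyl_mulX.
have act_mu g p : g \in W -> act g (iota (weyl_mulM p)) = iota (weyl_mulM (GLop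
  e g p)).
  by move=> gW; rewrite hact // weylact_mul.
have act_d g j : g \in W ->
    act g (iota (weylP K j)) = \sum_k coord e k (g e`_j) *: iota (weylP K k).
  move=> gW; rewrite hact // weylact_der linear_sum.
  by apply: eq_bigr => k _; rewrite linearZ.
have [psi [psi_inj psi_fix]] := fixed_image (@weyl_mul_inj K n) (@weylPC K n)
  (@bracket_weylP K n) A_ind hF hW.1 (GLop1 he) (GLopM he) act_mu act_d
  f_inv f_gen J_neq0 (mu := mu) (fun=> erefl).
have val_fix (u : invariants W act) : forall g, g \in W -> act g (val u) = val
  u.
  by move=> g gW; case: u => u /= /asboolP; apply.
have /choice [phi phiE] : forall u : invariants W act, exists x, val u = psi x.
  by move=> u; apply/psi_fix/val_fix.
have phi_linear : linear phi.
  by move=> a u v; apply: psi_inj; rewrite -phiE [RHS]linearP /= -!phiE.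
have phi_monoid : monoid_morphism phi.
  split=> [|u v]; apply: psi_inj; first by rewrite -phiE [RHS]rmorph1.
  by rewrite -phiE [RHS]rmorphM /= -!phiE.
exists (mk_lrmorphism phi_linear phi_monoid).
have psi_mem x : psi x \in invariant_pred W act.
  by apply/asboolP; apply/psi_fix; exists x.
exists (fun x => Invariants (psi_mem x)) => [u|x].
  by apply: val_inj; rewrite /= -phiE.
by apply: psi_inj; rewrite /= -phiE.
Qed.

Unset Implicit Arguments.

Theorem theorem2 (R : realType) (n : nat) (V : vectType R[i])
    (e : n.-tuple V) (he : basis_of {:V} e)
    (W : {fset GL V}) (hW : complex_reflection_group W)
    (F : unitAlgType R[i]) (iota : {lrmorphism weyl R[i] n -> F})
    (hF : skew_field_of_fractions iota)
    (act : GL V -> {lrmorphism F -> F})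
    (hact : forall g, g \in W -> forall d : weyl R[i] n,
      act g (iota d) = iota (weylact he g d)) :
  exists phi : {lrmorphism invariants W act -> F}, bijective phi.
Proof. exact: invariants_isomorphism hact. Qed.
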